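(* Let $K$ be a field and $S=K[x_1,\dots,x_n]$ the standard graded polynomial ring. Let $I\subset S$ be a homogeneous ideal with $\dim S/I=0$, and let $s,t\in\mathbb{N}$. Assume that the characteristic of $K$ is either $0$ or $>s+t$. Then $$\operatorname{reg} Z_{s+t}(I,S)\leq \operatorname{reg} Z_s(I,S)+\operatorname{reg} Z_t(I,S).$$
   Context: Let $f_1,\dots,f_m$ be a minimal system of homogeneous generators of $I$, let $F=\bigoplus_{i=1}^m S(-\deg f_i)$ with basis $e_1,\dots,e_m$ ($\deg e_i=\deg f_i$), and let $\phi:F\to S$, $\phi(e_i)=f_i$. The Koszul complex $K(I,S)=\bigwedge^\bullet F$ has differential induced by $\phi$ (of degree $0$); for a graded $S$-module $M$, $K(I,M)=K(I,S)\otimes_S M$. $Z_t(I,M)$ denotes the graded $S$-module of cycles of $K(I,M)$ in homological position $t$. $\operatorname{reg}$ denotes Castelnuovo–Mumford regularity, with the convention that the zero module has regularity $-\infty$. *)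

(* Defs.v *)
From HB Require Import structures.
From mathcomp Require Import all_boot all_order all_algebra.
From mathcomp Require Import mpoly.
Set Implicit Arguments. Unset Strict Implicit. Unset Printing Implicit Defensive.
Import Order.TTheory GRing.Theory Num.Theory.
Local Open Scope ring_scope.

Section Defs.
Variables (K : fieldType) (n : nat).
Local Notation P := {mpoly K[n]}.

Definition in_gen_ideal {m : nat} (f : 'I_m -> P) (A : pred 'I_m) (g : P) : Prop :=
  exists c : 'I_m -> P, g = \sum_(i < m | A i) c i * f i.

Definition minimal_generators {m : nat} (f : 'I_m -> P) : Prop :=
  forall i : 'I_m, ~ in_gen_ideal f (fun j => j != i) (f i).

Definition is_prime_ideal (Q : P -> Prop) : Prop :=
  [/\ Q 0, (forall a b, Q a -> Q b -> Q (a + b)), (forall a b, Q b -> Q (a * b)),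
      ~ Q 1 & (forall a b, Q (a * b) -> Q a \/ Q b)].

Definition krull_dim_quot_zero (I : P -> Prop) : Prop :=
  (exists Q, is_prime_ideal Q /\ forall g, I g -> Q g) /\
  (forall Q1 Q2, is_prime_ideal Q1 -> is_prime_ideal Q2 ->
     (forall g, I g -> Q1 g) -> (forall g, Q1 g -> Q2 g) ->
     forall g, Q2 g -> Q1 g).

(* A graded free module is given by a finite index type T of basis elements
   and a degree function T -> nat; elements are functions T -> P.  A map
   between free modules with bases I and J is given by a matrix A : I -> J -> P
   acting on (row) vectors. *)
Definition lin_app {I J : finType} (A : I -> J -> P) (u : I -> P) : J -> P :=
  fun j => \sum_i u i * A i j.

Definition homog_map {I J : finType} (da : I -> nat) (db : J -> nat)
  (A : I -> J -> P) : Prop :=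
  forall i j, A i j = 0 \/ ((db j <= da i)%N /\ A i j \is (da i - db j)%N.-homog).

Definition in_ker {I J : finType} (A : I -> J -> P) (u : I -> P) : Prop :=
  forall j, lin_app A u j = 0.
Definition in_im {I J : finType} (A : I -> J -> P) (v : J -> P) : Prop :=
  exists u, forall j, v j = lin_app A u j.

(* reg_le dG M a : the graded submodule M of the graded free module (T, dG)
   has Castelnuovo-Mumford regularity <= a, i.e. M has a finite graded free
   resolution
     0 -> F_k -> ... -> F_1 -> F_0 -> M -> 0,  F_i = (+)_p S(-dg i p),
   with all generator degrees dg i p <= a + i.  (Taking the minimal
   resolution, this is equivalent to reg M <= a; the zero module satisfies
   reg_le for every a, matching reg 0 = -oo.) *)
Definition reg_le {T : finType} (dG : T -> nat) (M : (T -> P) -> Prop) (a : int)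
  : Prop :=
  exists (r : nat -> nat) (dg : forall i, 'I_(r i) -> nat)
         (d0 : 'I_(r 0) -> T -> P) (d : forall i, 'I_(r i.+1) -> 'I_(r i) -> P),
  (exists k, forall i, (k < i)%N -> r i = 0%N) /\
  homog_map (dg 0%N) dG d0 /\
  (forall i, homog_map (dg i.+1) (dg i) (d i)) /\
  (forall v, M v <-> in_im d0 v) /\
  (forall u, in_ker d0 u <-> in_im (d 0%N) u) /\
  (forall i u, in_ker (d i) u <-> in_im (d i.+1) u) /\
  (forall i (p : 'I_(r i)), ((dg i p)%:Z <= a + i%:Z)).

Section Koszul.
Variables (m : nat) (f : 'I_m -> P) (df : 'I_m -> nat).

(* basis of the t-th exterior power of F: t-subsets J of {1..m} *)
Definition kbasis (t : nat) : finType := {J : {set 'I_m} | #|J| == t}.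

Definition kdeg (t : nat) (J : kbasis t) : nat := (\sum_(i in val J) df i)%N.

(* coefficient of e_J' in d(e_J):  d(e_{j1} /\ ... /\ e_{jt}) =
   sum_k (-1)^(k+1) f_{jk} e_{j1} /\ .. ^jk .. /\ e_{jt}, j1 < ... < jt *)
Definition kdiff (J J' : {set 'I_m}) : P :=
  \sum_(i in J | J' == J :\ i) (-1) ^+ #|[set k in J | (k < i)%N]| * f i.

Definition Zcyc (t : nat) (v : kbasis t -> P) : Prop :=
  forall J' : {set 'I_m}, \sum_(J : kbasis t) v J * kdiff (val J) J' = 0.

End Koszul.
End Defs.

(* Main.v *)
(* Regularity bounds are transported through Koszul homology with respect to the
   variables, and no local cohomology is used.

   Let [N] be the module of bicycles of [K_s (x) K_t], that is, of elements killed
   by both Koszul differentials of [f].  Comultiplication and multiplication in the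
   exterior algebra make [Z_{s+t}] a direct summand of [N], since their composite is
   the binomial coefficient [C(s+t, s)], a unit.  If [F] and [G] are resolutions of
   [Z_s] and [Z_t], then multiplication by each [f_i] on [Z_s] factors through a free
   module, so that the complex [F (x) G -> N] has homology annihilated by the ideal,
   hence by a power of each variable.  Regularity of the sequence of powers
   [x_j^q] forces this homology to vanish above an explicit degree.  From this, the
   Koszul homology [H_i(x; N)], and with it its summand [H_i(x; Z_{s+t})], vanishes
   in degrees above [a + b + i], and a graded module with this property has a
   resolution with the required degrees, constructed by taking minimal generators of
   the successive syzygies. *)

Require Import Defs.
From HB Require Import structures.
From mathcomp Require Import all_boot all_order all_algebra.
From mathcomp Require Import mpoly.
From mathcomp Require Import zify ring.
From mathcomp Require boolp classical_sets.
From Stdlib Require Import Classical.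
Set Implicit Arguments. Unset Strict Implicit. Unset Printing Implicit Defensive.
Import Order.TTheory GRing.Theory Num.Theory.
Local Open Scope ring_scope.

(** * Monomial truncations and monomial ideals *)

Section Monomials.
Variables (K : fieldType) (n : nat).
Local Notation P := {mpoly K[n]}.
Implicit Types (p u w : P) (m : 'X_{1..n}).

(** [F (x) G] is usually no resolution of [N]: it carries [Tor] homology, and its augmentation to
    [N] need not be onto. It is enough that these defects are torsion and disappear early: the
    cokernel from degree [a + b] on, the homology in position [j] of [F (x) G] from degree
    [a + b + j + 1] on. The bound comes from a count. Lifting [x_r^q v] raises the degree by [q],
    but the admissible degree of the next position by only 1: a gain of [q - 1] per variable. After
    all variables the gain is [n(q - 1)], the socle degree of [S/(x_0^q, ..., x_{n-1}^q)], which
    forces all coefficients into the ideal of the powers. The Koszul homology of [N] then moves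
    along the complex one position at a time, in constant total degree, down to [H_0], where the
    generator degrees of a free module decide. Degrees are expressed by truncations, so that any
    witness can afterwards be cut down to the required degrees. *)

Definition mgen (k : nat) (E : 'X_{1..n} -> K) : P :=
  \sum_(m : 'X_{1..n < k}) E m *: 'X_[m].

Lemma mcoeff_mgen k (E : 'X_{1..n} -> K) m :
  (forall m', E m' != 0 -> (mdeg m' < k)%N) -> (mgen k E)@_m = E m.
Proof.
move=> hE; case: (ltnP (mdeg m) k) => hm; first exact: mcoeff_mpoly.
rewrite /mgen raddf_sum big1 /=; first by have := contraNeq (hE m) => ->; rewrite // -leqNgt.
move=> i _; rewrite mcoeffZ mcoeffX; case: eqP => [e|]; rewrite ?mulr0 //.
by have := bmdeg i; rewrite e ltnNge hm.
Qed.

Lemma mcoeff_msize p m : p@_m != 0 -> (mdeg m < msize p)%N.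
Proof. by rewrite -mcoeff_msupp => /msize_mdeg_lt. Qed.

Definition mfilt (phi : pred 'X_{1..n}) p : P :=
  mgen (msize p) (fun m => if phi m then p@_m else 0).

Lemma mcoeff_mfilt phi p m : (mfilt phi p)@_m = if phi m then p@_m else 0.
Proof.
by apply: mcoeff_mgen => m'; case: ifP => [_ /mcoeff_msize|]; rewrite ?eqxx.
Qed.

Definition mdivX (k : 'X_{1..n}) p : P := mgen (msize p) (fun m => p@_(m + k)).

Lemma mcoeff_mdivX k p m : (mdivX k p)@_m = p@_(m + k).
Proof.
apply: mcoeff_mgen => m' /mcoeff_msize; rewrite mdegD; exact/leq_ltn_trans/leq_addr.
Qed.

Lemma mcoeffXM k p m :
  ('X_[k] * p)@_m = if (k <= m)%MM then p@_(m - k) else 0.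
Proof.
rewrite mulrC; case: ifP => h; first by rewrite -[in LHS](submK h) addmC mcoeffMX.
apply/memN_msupp_eq0/negP; rewrite (perm_mem (msuppMX _ _)) => /mapP[x _ e].
by move: h; rewrite e; move/negP; apply; apply/mnm_lepP => i; rewrite mnmDE leq_addr.
Qed.

Lemma mcoeffM_neq0 p u m : (p * u)@_m != 0 ->
  exists m1 m2, [/\ p@_m1 != 0, u@_m2 != 0 & m = (m1 + m2)%MM].
Proof.
rewrite -mcoeff_msupp => /msuppM_le /allpairsP[[m1 m2] [/= h1 h2 ->]].
by exists m1, m2; rewrite -!mcoeff_msupp h1 h2.
Qed.

Definition xmon (r : nat) : 'X_{1..n} := [multinom (nat_of_ord j == r : nat) | j < n].

Lemma xmonE r q (j : 'I_n) : (xmon r *+ q)%MM j = if nat_of_ord j == r then q else 0%N.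
Proof. by rewrite mulmnE /xmon mnmE; case: eqP; rewrite ?mul1n. Qed.

Lemma mdeg_xmon r q : (r < n)%N -> mdeg (xmon r *+ q)%MM = q.
Proof.
move=> h; rewrite mdegE (bigD1 (Ordinal h)) //= xmonE eqxx big1 ?addn0 // => i hi.
by rewrite xmonE; case: eqP => // e; case/eqP: hi; apply: val_inj.
Qed.

Lemma xmon_ord (j : 'I_n) : xmon j = U_(j)%MM.
Proof.
by apply/mnmP => i; rewrite mnm1E /xmon mnmE eq_sym.
Qed.

Definition xpow (q r : nat) : P := 'X_[xmon r *+ q].

Lemma xpow_ord q (j : 'I_n) : xpow q j = 'X_j ^+ q.
Proof. by rewrite mpolyXn /xpow xmon_ord. Qed.

Lemma xpowD q1 q2 r : xpow (q1 + q2) r = xpow q1 r * xpow q2 r.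
Proof.
rewrite /xpow -mpolyXD; congr 'X_[_]; apply/mnmP => j; rewrite mnmDE !xmonE.
by case: ifP.
Qed.

(* Membership in the ideal [(x_0^q, ..., x_{r-1}^q)], read off from the monomials. *)
Definition inJ (q r : nat) p : Prop :=
  forall m, p@_m != 0 -> exists2 j : 'I_n, (j < r)%N & (q <= m j)%N.

Lemma inJ0 q r : inJ q r 0.
Proof. by move=> m; rewrite mcoeff0 eqxx. Qed.

Lemma inJ_le q r r' p : (r <= r')%N -> inJ q r p -> inJ q r' p.
Proof. by move=> h hp m /hp [j hj hq]; exists j => //; apply: leq_trans h. Qed.

Lemma inJD q r p u : inJ q r p -> inJ q r u -> inJ q r (p + u).
Proof.
move=> hp hu m; rewrite mcoeffD => h.
have [e|/hp //] := eqVneq (p@_m) 0.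
by apply: hu; move: h; rewrite e add0r.
Qed.

Lemma inJM q r p u : inJ q r u -> inJ q r (p * u).
Proof.
move=> hu m /mcoeffM_neq0 [m1 [m2 [_ /hu [j hj hq] ->]]].
by exists j => //; rewrite mnmDE (leq_trans hq) // leq_addl.
Qed.

Lemma inJ_r0 q p : inJ q 0 p -> p = 0.
Proof.
move=> h; apply/mpolyP => m; rewrite mcoeff0; apply/eqP/negPn/negP => /h [j].
by rewrite ltn0.
Qed.

Lemma inJ_xpow q r j p : (j < r)%N -> (j < n)%N -> inJ q r (xpow q j * p).
Proof.
move=> h1 h2; rewrite mulrC; apply: inJM => m; rewrite /xpow mcoeffX.
have [<- _|_] := eqVneq (xmon j *+ q)%MM m; last by rewrite eqxx.
by exists (Ordinal h2) => //; rewrite xmonE /= eqxx.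
Qed.

(** This is the regularity of the sequence of powers: multiplying by a power of [x_r] leaves the
    exponents of all [x_j] with [j < r] unchanged. *)
Lemma inJ_reg q q' r p : inJ q r (xpow q' r * p) -> inJ q r p.
Proof.
move=> h m hm; have [|j hj hq] := h (m + xmon r *+ q')%MM.
  rewrite /xpow mcoeffXM ifT ?addmK //.
  by apply/mnm_lepP => i; rewrite mnmDE leq_addl.
exists j => //; move: hq; rewrite mnmDE xmonE ifF ?addn0 //.
by apply/eqP => e; rewrite e ltnn in hj.
Qed.

(** The monomials divisible by [x_r^q] are collected in the quotient; every other monomial of [p]
    owes its membership to an earlier variable. *)
Lemma inJ_split q r p : (r < n)%N -> inJ q r.+1 p ->
  inJ q r (p - xpow q r * mdivX (xmon r *+ q) p).
Proof.
move=> hr hp m; rewrite mcoeffB /xpow mcoeffXM mcoeff_mdivX; case: ifP => [h|h].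
  by rewrite submK // subrr eqxx.
rewrite subr0 => /hp [j]; rewrite ltnS leq_eqVlt => /orP[/eqP e|hj hq]; last by exists j.
move=> hq; move/negP: h; case; apply/mnm_lepP => i; rewrite xmonE; case: eqP => // ei.
by rewrite (_ : i = j) //; apply: val_inj; rewrite /= ei e.
Qed.

Lemma inJ_mfilt q r phi p : inJ q r p -> inJ q r (mfilt phi p).
Proof. by move=> h m; rewrite mcoeff_mfilt; case: ifP => [_|]; rewrite ?eqxx //; exact: h. Qed.

(* The socle degree of [S/(x_0^q, ..., x_{n-1}^q)] is [n(q-1)]. *)
Lemma inJ_top q p : (forall m, p@_m != 0 -> (n * q.-1 < mdeg m)%N) -> inJ q n p.
Proof.
move=> h m /h hm; have [/existsP[j hj]|/existsPn hq] := boolP [exists j, q <= m j]%N.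
  by exists j.
move: hm; rewrite ltnNge; case/negP.
rewrite mdegE -[X in (_ <= X * _)%N]card_ord -sum_nat_const; apply: leq_sum => j _.
by have := hq j; rewrite -ltnNge; case: (q).
Qed.

Lemma inJ1_top p : p@_0%MM = 0 -> inJ 1 n p.
Proof.
move=> h; apply: inJ_top => m hm; rewrite muln0 lt0n mdeg_eq0.
by apply: contraNneq hm => ->; rewrite h.
Qed.

(** The threshold is an integer since shifts by degrees of basis elements may make it negative. It
    is strict, so truncation at [-1] is the identity. *)
Definition tr (e : int) p : P := mfilt (fun m => e < (mdeg m)%:Z) p.

Lemma mcoeff_tr e p m : (tr e p)@_m = if e < (mdeg m)%:Z then p@_m else 0.
Proof. exact: mcoeff_mfilt. Qed.

Lemma tr_is_zmod_morphism e : zmod_morphism (tr e).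
Proof.
move=> p u; apply/mpolyP => m; rewrite mcoeffB !mcoeff_tr mcoeffB.
by case: ifP => // _; rewrite subrr.
Qed.
HB.instance Definition _ e := GRing.isZmodMorphism.Build P P (tr e) (@tr_is_zmod_morphism e).

Lemma tr_id e p : (forall m, p@_m != 0 -> e < (mdeg m)%:Z) -> tr e p = p.
Proof.
move=> h; apply/mpolyP => m; rewrite mcoeff_tr; case: ifP => // hm.
by apply/esym/eqP/negPn/negP => /h; rewrite hm.
Qed.

Lemma tr_eq0 e p : (forall m, p@_m != 0 -> ~~ (e < (mdeg m)%:Z)) -> tr e p = 0.
Proof.
move=> h; apply/mpolyP => m; rewrite mcoeff_tr mcoeff0; case: ifP => // hm.
by apply/eqP/negPn/negP => /h; rewrite hm.
Qed.

Lemma tr_mul_homog e (k : nat) p a : a \is k.-homog -> tr (e + k%:Z) (p * a) = tr e p * a.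
Proof.
move=> /dhomogP ha.
have ha' m2 : a@_m2 != 0 -> mdeg m2 = k by rewrite -mcoeff_msupp => /ha.
rewrite -{1}(subrK (tr e p) p) mulrDl raddfD /=.
have -> : tr (e + k) ((p - tr e p) * a) = 0.
  apply: tr_eq0 => m /mcoeffM_neq0[m1 [m2 [h1 /ha' e2 ->]]].
  move: h1; rewrite mcoeffB mcoeff_tr; case: ifP => [_|h _]; first by rewrite subrr eqxx.
  by rewrite mdegD PoszD; lia.
rewrite add0r; apply: tr_id => m /mcoeffM_neq0[m1 [m2 [h1 /ha' e2 ->]]].
move: h1; rewrite mcoeff_tr; case: ifP => [h _|]; rewrite ?eqxx // mdegD PoszD.
by lia.
Qed.

Lemma xpow_homog q r : (r < n)%N -> xpow q r \is q.-homog.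
Proof. by move=> h; rewrite dhomogX /= mdeg_xmon. Qed.

End Monomials.

(** * Graded free modules *)

(* A type alias: [{ffun T -> {mpoly K[n]}}] already carries the structure of a
   [K]-module, whereas here the scalars have to be the polynomials. *)
Definition fvec (K : fieldType) (n : nat) (T : finType) := {ffun T -> {mpoly K[n]}}.
HB.instance Definition _ K n T := GRing.Zmodule.on (@fvec K n T).

Section Fvec.
Variables (K : fieldType) (n : nat).
Local Notation P := {mpoly K[n]}.
Local Notation fvec := (@fvec K n).

Definition fvscale (T : finType) (a : P) (u : fvec T) : fvec T := [ffun i => a * u i].

Fact fvscaleA T a b (u : fvec T) : fvscale a (fvscale b u) = fvscale (a * b) u.
Proof. by apply/ffunP => i; rewrite !ffunE mulrA. Qed.
Fact fvscale1 T : left_id 1 (@fvscale T).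
Proof. by move=> u; apply/ffunP => i; rewrite !ffunE mul1r. Qed.
Fact fvscaleDr T : right_distributive (@fvscale T) +%R.
Proof. by move=> a u v; apply/ffunP => i; rewrite !ffunE mulrDr. Qed.
Fact fvscaleDl T (v : fvec T) : {morph (@fvscale T)^~ v : a b / a + b}.
Proof. by move=> a b; apply/ffunP => i; rewrite !ffunE mulrDl. Qed.
HB.instance Definition _ T := GRing.Zmodule_isLmodule.Build P (fvec T)
  (@fvscaleA T) (@fvscale1 T) (@fvscaleDr T) (@fvscaleDl T).

Lemma fvE (T : finType) i :
  (forall u v : fvec T, (u + v) i = u i + v i) * (forall u : fvec T, (- u) i = - u i) *
  (forall a (u : fvec T), (a *: u) i = a * u i) * ((0 : fvec T) i = 0).
Proof. by do !split; move=> *; rewrite !ffunE. Qed.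

Lemma fv_sumE (T : finType) I (r : seq I) (Q : pred I) (F : I -> fvec T) i :
  (\sum_(j <- r | Q j) F j) i = \sum_(j <- r | Q j) F j i.
Proof. by elim/big_rec2: _ => [|j y1 y2 _ <-]; rewrite !ffunE. Qed.

Definition trunc (T : finType) (dg : T -> nat) (e : int) (u : fvec T) : fvec T :=
  [ffun i => tr (e - (dg i)%:Z) (u i)].

Definition above (T : finType) (dg : T -> nat) (e : int) (u : fvec T) := trunc dg e u = u.

(** With a predicate selecting the basis elements in use, all homological positions of a complex can
    share one index type. *)
Definition supp (T : finType) (A : pred T) (u : fvec T) := forall i, ~~ A i -> u i = 0.

Definition vJ (T : finType) (q r : nat) (u : fvec T) := forall i, inJ q r (u i).

Section Basics.
Variables (T : finType) (dg : T -> nat).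
Implicit Types (u v w : fvec T).

Lemma trunc_is_zmod_morphism e : zmod_morphism (trunc dg e).
Proof. by move=> u v; apply/ffunP => i; rewrite !ffunE raddfB. Qed.
HB.instance Definition _ e :=
  GRing.isZmodMorphism.Build (fvec T) (fvec T) (trunc dg e) (@trunc_is_zmod_morphism e).

Lemma above_trunc e u : above dg e (trunc dg e u).
Proof.
apply/ffunP => i; rewrite !ffunE; apply: tr_id => m.
by rewrite mcoeff_tr; case: ifP; rewrite ?eqxx.
Qed.

Lemma aboveP e u : above dg e u <->
  (forall i m, (u i)@_m != 0 -> e < (mdeg m + dg i)%N%:Z).
Proof.
split=> [h i m|h].
  by rewrite -h ffunE mcoeff_tr; case: ifP => [h1 _|]; rewrite ?eqxx // PoszD; lia.
by apply/ffunP => i; rewrite ffunE; apply: tr_id => m /h; rewrite PoszD; lia.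
Qed.

Lemma above_le e e' u : e' <= e -> above dg e u -> above dg e' u.
Proof. by move=> he /aboveP h; apply/aboveP => i m /h; apply: le_lt_trans. Qed.

Lemma above0 e : above dg e 0.
Proof. exact: raddf0. Qed.

Lemma aboveD e u v : above dg e u -> above dg e v -> above dg e (u + v).
Proof. by move=> hu hv; rewrite /above raddfD /= hu hv. Qed.

Lemma aboveN e u : above dg e u -> above dg e (- u).
Proof. by move=> hu; rewrite /above raddfN /= hu. Qed.

Lemma trunc_homogZ e (k : nat) a u : a \is k.-homog ->
  trunc dg (e + k%:Z) (a *: u) = a *: trunc dg e u.
Proof.
move=> ha; apply/ffunP => i; rewrite !ffunE mulrC [RHS]mulrC -(tr_mul_homog _ _ ha).
by congr tr; lia.
Qed.

Lemma above_homogZ e (k : nat) a u : a \is k.-homog -> above dg e u ->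
  above dg (e + k%:Z) (a *: u).
Proof. by move=> ha hu; rewrite /above trunc_homogZ // hu. Qed.

Lemma supp0 (A : pred T) : supp A 0.
Proof. by move=> i _; rewrite fvE. Qed.

Lemma suppD (A : pred T) u v : supp A u -> supp A v -> supp A (u + v).
Proof. by move=> hu hv i hi; rewrite fvE hu // hv // addr0. Qed.

Lemma suppZ (A : pred T) a u : supp A u -> supp A (a *: u).
Proof. by move=> hu i hi; rewrite fvE hu // mulr0. Qed.

Lemma suppN (A : pred T) u : supp A u -> supp A (- u).
Proof. by rewrite -scaleN1r; exact: suppZ. Qed.

Lemma supp_trunc (A : pred T) e u : supp A u -> supp A (trunc dg e u).
Proof. by move=> hu i hi; rewrite ffunE hu // raddf0. Qed.

Lemma suppB (A : pred T) u v : supp A u -> supp A v -> supp A (u - v).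
Proof. by move=> hu hv; apply: suppD => //; apply: suppN. Qed.

Lemma vJ_D q r u v : vJ q r u -> vJ q r v -> vJ q r (u + v).
Proof. by move=> hu hv i; rewrite fvE; apply: inJD. Qed.

Lemma vJ_Z q r a u : vJ q r u -> vJ q r (a *: u).
Proof. by move=> hu i; rewrite fvE; apply: inJM. Qed.

Lemma vJ_N q r u : vJ q r u -> vJ q r (- u).
Proof. by rewrite -scaleN1r; apply: vJ_Z. Qed.

Lemma vJ_le q r r' u : (r <= r')%N -> vJ q r u -> vJ q r' u.
Proof. by move=> h hu i; apply: inJ_le (hu i). Qed.

Lemma vJ_r0 q u : vJ q 0 u -> u = 0.
Proof. by move=> h; apply/ffunP => i; rewrite fvE (inJ_r0 (h i)). Qed.

Lemma vJ_0 q r : vJ q r (0 : fvec T).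
Proof. by move=> i; rewrite fvE; apply: inJ0. Qed.

Lemma vJ_reg q q' r u : vJ q r (xpow K n q' r *: u) -> vJ q r u.
Proof. by move=> h i; move: (h i); rewrite fvE; apply: inJ_reg. Qed.

Lemma vJ_xpow q r j u : (j < r)%N -> (j < n)%N -> vJ q r (xpow K n q j *: u).
Proof. by move=> h1 h2 i; rewrite fvE; apply: inJ_xpow. Qed.

Lemma vJ_trunc q r e u : vJ q r u -> vJ q r (trunc dg e u).
Proof. by move=> h i; rewrite ffunE; apply: inJ_mfilt. Qed.

Lemma vJ_split (A : pred T) q r u : (r < n)%N -> vJ q r.+1 u -> supp A u ->
  exists2 w, supp A w & vJ q r (u - xpow K n q r *: w).
Proof.
move=> hr hu hA; exists [ffun i => if A i then mdivX (xmon n r *+ q) (u i) else 0].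
  by move=> i /negbTE hi; rewrite ffunE hi.
move=> i; rewrite !fvE ffunE; case: ifP => hi; first exact: inJ_split.
by rewrite hA ?hi // mulr0 subr0; apply: inJ0.
Qed.

Lemma vJ_top (A : pred T) q (c : int) u : supp A u ->
  (forall i, A i -> (dg i)%:Z <= c) ->
  above dg (c + (n * q.-1)%N%:Z) u -> vJ q n u.
Proof.
move=> hA hc /aboveP h i; have [hi|hi] := boolP (A i); last by rewrite hA //; apply: inJ0.
by apply: inJ_top => m /h; have := hc _ hi; rewrite PoszD; lia.
Qed.

End Basics.

Lemma fmapZ (T T' : finType) (f : {linear fvec T -> fvec T'}) a u : f (a *: u) = a *: f u.
Proof. exact: linearZ. Qed.

Lemma fmapB (T T' : finType) (f : {linear fvec T -> fvec T'}) u v : f (u - v) = f u - f v.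
Proof. exact: raddfB. Qed.

Lemma fmapD (T T' : finType) (f : {linear fvec T -> fvec T'}) u v : f (u + v) = f u + f v.
Proof. exact: raddfD. Qed.

Lemma fmap0 (T T' : finType) (f : {linear fvec T -> fvec T'}) : f 0 = 0.
Proof. exact: raddf0. Qed.

(** Commuting with every truncation stands for being homogeneous of degree 0; it is the form in
    which witnesses get truncated. *)
Definition graded_map (T T' : finType) (dg : T -> nat) (dg' : T' -> nat)
    (f : fvec T -> fvec T') :=
  forall e u, f (trunc dg e u) = trunc dg' e (f u).

Lemma above_map (T T' : finType) (dg : T -> nat) (dg' : T' -> nat) (f : fvec T -> fvec T') e u :
  graded_map dg dg' f -> above dg e u -> above dg' e (f u).
Proof. by move=> hf hu; rewrite /above -hf hu. Qed.

(** * Complexes whose homology is torsion at the origin *)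

Section TorsionHomology.
Variables (B : nat -> finType) (dg : forall k, B k -> nat) (A : forall k, pred (B k)).
Variable d : forall k, {linear fvec (B k.+1) -> fvec (B k)}.
Hypothesis d_supp : forall k u, supp (@A k.+1) u -> supp (@A k) (d k u).
Hypothesis dd0 : forall k u, supp (@A k.+2) u -> d k (d k.+1 u) = 0.
Hypothesis d_graded : forall k, graded_map (@dg k.+1) (@dg k) (d k).

(** Membership is read off monomials, which [d] does not respect; splitting off one power [x_r^q] at
    a time gives a form to which linearity applies. *)
Let vJ_d q r k (u : fvec (B k.+1)) : (r <= n)%N -> supp (@A k.+1) u ->
  vJ q r u -> vJ q r (d k u).
Proof.
elim: r u => [|r IH] u hr hA hu.
  by rewrite (vJ_r0 hu) fmap0; apply: vJ_0.
have [w hw huw] := vJ_split hr hu hA.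
rewrite -(subrK (xpow K n q r *: w) u) fmapD; apply: vJ_D; last first.
  by rewrite fmapZ; apply: vJ_xpow.
apply: vJ_le (leqnSn r) _; apply: IH => //; first exact: ltnW.
by apply: suppB => //; apply: suppZ.
Qed.

Section Torsion.
Variable q0 : nat.
Hypothesis tors : forall k (v : fvec (B k.+1)) (j : nat), (j < n)%N -> supp (@A k.+1) v ->
  d k v = 0 -> exists2 w, supp (@A k.+2) w & xpow K n q0 j *: v = d k.+1 w.

(** Let [C_r] be the complex modulo the first [r] powers. Multiplication by [x_r^q] on [C_r] has
    cokernel [C_(r+1)], and the long exact sequence places the homology of [C_(r+1)] between that of
    [C_r] in two adjacent positions. Annihilating exponents add up, hence the doubling in
    [2 ^ r]. *)
Lemma torsion_mod_powers q r k (v : fvec (B k.+1)) (j : nat) :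
  (j < n)%N -> (r <= n)%N -> (r <= k)%N -> supp (@A k.+1) v -> vJ q r (d k v) ->
  exists2 w, supp (@A k.+2) w & vJ q r (xpow K n (2 ^ r * q0) j *: v - d k.+1 w).
Proof.
move=> hj; elim: r k v => [|r IH] k v hrn hrk hv hJ.
  have [w hw e] := tors hj hv (vJ_r0 hJ).
  by exists w => //; rewrite expn0 mul1n e subrr; apply: vJ_0.
case: k hrk v hv hJ => // k; rewrite ltnS => hrk v hv hJ.
have hrn' := ltnW hrn.
have [w hw hw2] := vJ_split hrn hJ (d_supp hv).
set g := xpow K n (2 ^ r * q0) j.
(* By regularity [w] is a cycle modulo the first [r] powers: it represents the image of [v] under
   the connecting map. *)
have [w' hw' hw2'] : exists2 w', supp (@A k.+2) w' & vJ q r (g *: w - d k.+1 w').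
  apply: IH => //; apply: (@vJ_reg _ q q r).
  have := vJ_d hrn' (suppB (d_supp hv) (suppZ _ hw)) hw2.
  by rewrite fmapB dd0 // sub0r (fmapZ (d k)) => /vJ_N; rewrite opprK.
(* The correction by [x_r^q w'] turns [g v] into a cycle modulo the first [r] powers, to which a
   second factor [g] applies. *)
have hv' : supp (@A k.+2) (g *: v - xpow K n q r *: w').
  by apply: suppB; apply: suppZ.
have [|w'' hw'' hw2''] := IH _ _ hrn' (leqW hrk) hv' _.
  rewrite fmapB !(fmapZ (d k.+1)).
  have -> : g *: d k.+1 v - xpow K n q r *: d k.+1 w' =
      g *: (d k.+1 v - xpow K n q r *: w) + xpow K n q r *: (g *: w - d k.+1 w').
    by rewrite !scalerBr !scalerA [g * _]mulrC addrA subrK.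
  by apply: vJ_D; apply: vJ_Z.
exists w'' => //; rewrite expnS mul2n -addnn mulnDl xpowD -/g -scalerA.
rewrite -(subrK (g *: (g *: v - xpow K n q r *: w')) (g *: (g *: v))) -addrA.
apply: vJ_D; last exact: vJ_le (leqnSn r) hw2''.
rewrite scalerBr opprB addrC subrK scalerA mulrC -scalerA.
exact: vJ_xpow.
Qed.

End Torsion.

Variable c : int.
Hypothesis tors : exists q0, forall k (v : fvec (B k.+1)) (j : nat), (j < n)%N ->
  supp (@A k.+1) v -> d k v = 0 ->
  exists2 w, supp (@A k.+2) w & xpow K n q0 j *: v = d k.+1 w.
Hypothesis n_gt0 : (0 < n)%N.
Hypothesis dg_le : forall k (b : B k.+2), A b -> (dg b)%:Z <= c + k%:Z.

(* The elements [x_r^q v] are lifted along [r], shifting the degree by [q] and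
   the homological position by one, until they vanish modulo all [x_j^q] for
   degree reasons; regularity of the sequence then allows to descend again. *)
Lemma homology_vanish k (v : fvec (B k.+1)) : supp (@A k.+1) v ->
  above (@dg k.+1) (c + k%:Z - 1) v -> d k v = 0 ->
  exists2 w, supp (@A k.+2) w & d k.+1 w = v.
Proof.
(* [q] dominates every exponent [2 ^ r * q0] with [r <= n]; the successor keeps it positive, so that
   [q.-1] really is [q - 1]. *)
have [q0 tors'] := tors; pose q := (2 ^ n * q0).+1.
pose goal r := forall k (v : fvec (B k.+1)), (r <= k)%N -> supp (@A k.+1) v ->
  above (@dg k.+1) (c + k%:Z - 1 + (r * q.-1)%N%:Z) v -> vJ q r (d k v) ->
  exists2 w, supp (@A k.+2) w & vJ q r (v - d k.+1 w).
suff main r : (r <= n)%N -> goal r.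
  move=> hv hab hd; have [||w hw hw'] := main 0 (leq0n n) k v (leq0n k) hv.
  - by rewrite mul0n addr0.
  - by rewrite hd; apply: vJ_0.
  exists w => //; apply/esym/eqP; rewrite -subr_eq0; apply/eqP; exact: vJ_r0 hw'.
(* Descending induction on [r]. At [r = n] the degree of [v] alone puts it into the ideal of the
   powers, and the position exceeds 1 because [k >= n > 0], so the generator bound is available. *)
move=> hr; rewrite -(subKn hr); elim: (n - r)%N (leq_subr r n) => {r hr k v}[|r IH] hr.
  rewrite subn0 => -[|k] v hk hv hab hd; first by rewrite leqNgt n_gt0 in hk.
  exists 0; first exact: supp0.
  rewrite fmap0 subr0; apply: (vJ_top hv) => [b hb|]; first exact: dg_le hb.
  by move: hab; apply: above_le; lia.
have hr0 := ltnW hr; have {IH} := IH hr0; rewrite -(subnSK hr); set r' := (n - r.+1)%N => IH.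
have hr' : (r' < n)%N by rewrite /r'; lia.
move=> k v hk hv hab hd.
have [w hw hw2] := torsion_mod_powers tors' hr' (ltnW hr') hk hv hd.
pose y := xpow K n (q - 2 ^ r' * q0) r'.
have hq : (2 ^ r' * q0 <= q)%N.
  by apply: leqW; rewrite leq_mul2r leq_exp2l // (ltnW hr') orbT.
have hy : y * xpow K n (2 ^ r' * q0) r' = xpow K n q r' by rewrite -xpowD subnK.
(* The factor [y] raises the exponent to [q]. Since [x_r'^q v] lies wholly above the threshold,
   truncating its lift there preserves the congruence. *)
pose w1 := trunc (@dg k.+2) (c + k%:Z - 1 + (r' * q.-1)%N%:Z + q%:Z) (y *: w).
have hw1 : supp (@A k.+2) w1 by apply: supp_trunc; apply: suppZ.
have hw1J : vJ q r' (xpow K n q r' *: v - d k.+1 w1).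
  have -> : xpow K n q r' *: v - d k.+1 w1 =
      trunc (@dg k.+1) (c + k%:Z - 1 + (r' * q.-1)%N%:Z + q%:Z)
        (y *: (xpow K n (2 ^ r' * q0) r' *: v - d k.+1 w)).
    rewrite scalerBr scalerA hy raddfB /= (trunc_homogZ _ _ _ (xpow_homog _ _ hr')) hab.
    by rewrite -(fmapZ (d k.+1)) -d_graded.
  by apply: vJ_trunc; apply: vJ_Z.
have [|||z hz hz2] := IH k.+1 w1 _ hw1.
- by rewrite ltnS.
- apply: above_le (above_trunc _ _ _).
  by rewrite /q /= mulSn; lia.
- rewrite -(subrK (xpow K n q r' *: v) (d _ w1)).
  apply: vJ_D; last exact: vJ_xpow.
  by rewrite -opprB; apply: vJ_N; apply: vJ_le (leqnSn _) hw1J.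
have hs : supp (@A k.+2) (w1 - d k.+2 z) by apply: suppB => //; apply: d_supp.
have [w2 hw2s hw2J] := vJ_split hr' hz2 hs.
(* Up to the boundary of [z], [w1] is [x_r'^q w2]. Applying [d] gives [x_r'^q (v - d w2)] in the
   ideal of the first [r'] powers, and regularity cancels the factor. *)
exists w2 => //; apply: (@vJ_reg _ q q r').
have h3 := vJ_d (ltnW hr') (suppB hs (suppZ _ hw2s)) hw2J.
rewrite !fmapB dd0 // subr0 (fmapZ (d k.+1)) in h3.
by have := vJ_D hw1J h3; rewrite addrA subrK scalerBr.
Qed.

End TorsionHomology.
End Fvec.

(** * The Koszul complex of the variables *)

Section Koszul.
Variables (K : fieldType) (n : nat).
Local Notation P := {mpoly K[n]}.
Local Notation fvec := (@fvec K n).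
Local Notation x_ r := (xpow K n 1 r).

(* The underlying module of the Koszul complex [K(x_0, ..., x_{r-1}; V)], built
   as an iterated mapping cone; [kin Q r i] describes the chains in homological
   position [i] whose coefficients satisfy [Q]. *)
Fixpoint kz (V : lmodType P) (r : nat) : lmodType P :=
  if r is r'.+1 then (kz V r' * kz V r')%type else V.

Fixpoint kd (V : lmodType P) (r : nat) : kz V r -> kz V r :=
  match r return kz V r -> kz V r with
  | 0%N => fun _ => 0
  | r'.+1 => fun z => (kd z.1 + x_ r' *: z.2, - kd z.2)
  end.

Fixpoint kmap (V W : lmodType P) (g : V -> W) (r : nat) : kz V r -> kz W r :=
  match r return kz V r -> kz W r with
  | 0%N => g
  | r'.+1 => fun z => (kmap g z.1, kmap g z.2)
  end.

Fixpoint kin (V : lmodType P) (Q : V -> Prop) (r i : nat) : kz V r -> Prop :=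
  match r return kz V r -> Prop with
  | 0%N => fun z => if i is 0%N then Q z else z = 0
  | r'.+1 => fun z => kin Q i z.1 /\ (if i is i'.+1 then kin Q i' z.2 else z.2 = 0)
  end.

Fixpoint k0 (V : lmodType P) (r : nat) : V -> kz V r :=
  match r return V -> kz V r with
  | 0%N => id
  | r'.+1 => fun u => (k0 r' u, 0)
  end.

Section General.
Variables (V W : lmodType P).

Lemma kd_is_linear r : linear (@kd V r).
Proof.
elim: r => [|r IH] a u v /=; first by rewrite scaler0 addr0.
congr (_, _); rewrite IH //= ?scalerDr ?scalerN ?opprD //.
by rewrite scalerA [_ * a]mulrC -scalerA addrACA.
Qed.
HB.instance Definition _ r := GRing.isLinear.Build P (kz V r) (kz V r) _ (@kd V r) (@kd_is_linear r).

Lemma kdZ r a (z : kz V r) : kd (a *: z) = a *: kd z.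
Proof. exact: linearZ. Qed.
Lemma kdB r (z y : kz V r) : kd (z - y) = kd z - kd y.
Proof. exact: raddfB. Qed.
Lemma kdN r (z : kz V r) : kd (- z) = - kd z.
Proof. exact: raddfN. Qed.

Lemma kd_kd r (z : kz V r) : kd (kd z) = 0.
Proof.
elim: r z => [|r IH] //= [a b] /=.
by rewrite raddfD /= IH kdZ add0r scalerN subrr kdN IH !oppr0.
Qed.

Variable Q : V -> Prop.
Hypothesis Q0 : Q 0.
Hypothesis QB : forall u v, Q u -> Q v -> Q (u - v).

Lemma kin0 r i : kin Q (r := r) i 0.
Proof. by elim: r i => [|r IH] [|i] /=. Qed.

Lemma kinB r i (z y : kz V r) : kin Q i z -> kin Q i y -> kin Q i (z - y).
Proof.
elim: r i z y => [|r IH] [|i] /=; first exact: QB.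
- by move=> ? ? -> ->; rewrite subr0.
- by move=> z y [h1 ->] [h2 ->]; split; [exact: IH | rewrite subr0].
- by move=> z y [h1 h3] [h2 h4]; split; exact: IH.
Qed.

Lemma kinN r i (z : kz V r) : kin Q i z -> kin Q i (- z).
Proof. by move=> h; rewrite -sub0r; apply: kinB => //; apply: kin0. Qed.

Lemma kinD r i (z y : kz V r) : kin Q i z -> kin Q i y -> kin Q i (z + y).
Proof. by move=> hz hy; rewrite -[y]opprK; apply: kinB => //; apply: kinN. Qed.

End General.

Lemma kin_sub (V : lmodType P) (Q Q' : V -> Prop) r i (z : kz V r) :
  (forall u, Q u -> Q' u) -> kin Q i z -> kin Q' i z.
Proof.
move=> h; elim: r i z => [|r IH] [|i] /=; first exact: h.
- by [].
- by move=> z [/IH ? ?].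
- by move=> z [/IH ? /IH ?].
Qed.

Lemma kin_gt (V : lmodType P) (Q : V -> Prop) r i (z : kz V r) : (r < i)%N -> kin Q i z -> z = 0.
Proof.
elim: r i z => [|r IH] [|i] //= [a b] /= hi [ha hb].
by rewrite (IH _ _ _ ha) ?(IH _ _ _ hb) // ltnW.
Qed.

Lemma kin_k0 (V : lmodType P) (Q : V -> Prop) r (z : kz V r) : kin Q 0 z -> exists2 u, Q u & z = k0 r u.
Proof.
elim: r z => [|r IH] /=; first by move=> z ?; exists z.
by move=> [a b] [/= /IH [u ? ->] ->]; exists u.
Qed.

Lemma k0_kin (V : lmodType P) (Q : V -> Prop) r u : Q u -> kin Q 0 (k0 r u).
Proof. by move=> h; elim: r => //= r IH; split. Qed.

Lemma kd_k0 (V : lmodType P) r (u : V) : kd (k0 r u) = 0.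
Proof. by elim: r => //= r ->; rewrite scaler0 raddf0 oppr0 addr0. Qed.

Lemma k0_is_linear (V : lmodType P) r : linear (@k0 V r).
Proof. by elim: r => //= r IH a u v; rewrite IH; congr (_, _); rewrite /= scaler0 addr0. Qed.
HB.instance Definition _ (V : lmodType P) r :=
  GRing.isLinear.Build P V (kz V r) _ (@k0 V r) (@k0_is_linear V r).

Lemma k0Z (V : lmodType P) r a (u : V) : k0 r (a *: u) = a *: k0 r u.
Proof. exact: linearZ. Qed.

Lemma kin_scale (V : lmodType P) (Q Q' : V -> Prop) r i a (z : kz V r) :
  (forall u, Q u -> Q' (a *: u)) -> kin Q i z -> kin Q' i (a *: z).
Proof.
move=> h; elim: r i z => [|r IH] [|i] /=; first exact: h.
- by move=> z ->; rewrite scaler0.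
- by move=> z [h1 ->]; rewrite scaler0; split => //; apply: IH.
- by move=> z [h1 h2]; split; apply: IH.
Qed.

Lemma kd_kin (V : lmodType P) (Q Q' : V -> Prop) r i (z : kz V r) : Q' 0 ->
  (forall u v, Q' u -> Q' v -> Q' (u - v)) ->
  (forall j u, (j < n)%N -> Q u -> Q' (x_ j *: u)) -> (r <= n)%N ->
  kin Q i.+1 z -> kin Q' i (kd z).
Proof.
move=> Q0 QB QX; elim: r i z => [|r IH] i /=; first by move=> *; apply: (@kin0 _ Q' Q0 0).
move=> [a b] hr [/= ha hb]; split.
  apply: (kinD Q0 QB); first by apply: IH => //; apply: ltnW.
  by apply: kin_scale hb => u; apply: QX.
case: i ha hb => [_ /kin_k0[u _ ->]|i _ hb]; first by rewrite kd_k0 oppr0.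
by apply: kinN => //; apply: IH => //; apply: ltnW.
Qed.

Section Functoriality.
Variables (V W : lmodType P) (g : V -> W).
Hypothesis g0 : g 0 = 0.

Lemma kmap0 r : kmap g (0 : kz V r) = 0.
Proof. by elim: r => //= r ->. Qed.

Lemma kin_kmap (Q : V -> Prop) (Q' : W -> Prop) r i (z : kz V r) :
  (forall u, Q u -> Q' (g u)) -> kin Q i z -> kin Q' i (kmap g z).
Proof.
move=> h; elim: r i z => [|r IH] [|i] /=; first exact: h.
- by move=> z ->.
- by move=> z [h1 ->]; rewrite kmap0; split => //; apply: IH.
- by move=> z [h1 h2]; split; apply: IH.
Qed.

Lemma kin_lift (Q : V -> Prop) (Q' : W -> Prop) r i (z : kz W r) :
  (forall u, Q' u -> exists2 v, Q v & g v = u) -> kin Q' i z ->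
  exists2 y, kin Q i y & kmap g y = z.
Proof.
move=> h; elim: r i z => [|r IH] [|i] /=; first exact: h.
- by move=> z ->; exists 0.
- by move=> [a b] [/= /IH [y hy <-] ->]; exists (y, 0) => //=; rewrite kmap0.
- by move=> [a b] [/= /IH [y hy <-] /IH [y' hy' <-]]; exists (y, y').
Qed.

Lemma kmap_eq0 (Q : V -> Prop) r i (z : kz V r) :
  (forall u, Q u -> g u = 0) -> kin Q i z -> kmap g z = 0.
Proof.
move=> h; elim: r i z => [|r IH] [|i] /=; first exact: h.
- by move=> z ->.
- by move=> [a b] [/= /IH -> ->]; rewrite kmap0.
- by move=> [a b] [/= /IH -> /IH ->].
Qed.

Lemma kin_ker (Q : V -> Prop) r i (z : kz V r) :
  kin Q i z -> kmap g z = 0 -> kin (fun u => Q u /\ g u = 0) i z.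
Proof.
elim: r i z => [|r IH] [|i] //=.
- by move=> [a b] /= [/IH ha ->] [/ha].
- by move=> [a b] /= [/IH ha /IH hb] [/ha ? /hb].
Qed.

End Functoriality.

Lemma kmap_eq (V W : lmodType P) (Q : V -> Prop) (g g' : V -> W) r i (z : kz V r) :
  (forall u, Q u -> g u = g' u) -> g 0 = 0 -> g' 0 = 0 ->
  kin Q i z -> kmap g z = kmap g' z.
Proof.
move=> h g0 g0'; elim: r i z => [|r IH] [|i] /=; first exact: h.
- by move=> z ->; rewrite g0 g0'.
- by move=> [a b] [/= /IH -> ->]; rewrite !kmap0.
- by move=> [a b] [/= /IH -> /IH ->].
Qed.

Lemma kmap_id (V : lmodType P) r (z : kz V r) : kmap id z = z.
Proof. by elim: r z => //= r IH [a b] /=; rewrite !IH. Qed.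

Lemma kmap_scale (V : lmodType P) a r (z : kz V r) : kmap (fun u => a *: u) z = a *: z.
Proof. by elim: r z => //= r IH [y y'] /=; rewrite !IH. Qed.

Lemma kmap_comp (V W X : lmodType P) (g : V -> W) (h : W -> X) r (z : kz V r) :
  kmap h (kmap g z) = kmap (h \o g) z.
Proof. by elim: r z => //= r IH [a b] /=; rewrite !IH. Qed.

Lemma kmapB (V W : lmodType P) (g : {additive V -> W}) r (z y : kz V r) :
  kmap g (z - y) = kmap g z - kmap g y.
Proof. by elim: r z y => [|r IH] z y /=; rewrite ?raddfB ?IH. Qed.

Lemma kd_kmap (V W : lmodType P) (g : {linear V -> W}) r (z : kz V r) : kd (kmap g z) = kmap g (kd z).
Proof.
have kmapN s (y : kz V s) : kmap g (- y) = - kmap g y.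
  by rewrite -sub0r kmapB kmap0 ?sub0r ?raddf0.
have kmapD s (y y' : kz V s) : kmap g (y + y') = kmap g y + kmap g y'.
  by rewrite -[y' in LHS]opprK kmapB kmapN opprK.
have kmapZ s a (y : kz V s) : kmap g (a *: y) = a *: kmap g y.
  by elim: s y => [|s IH] y /=; rewrite ?linearZ ?IH.
elim: r z => [|r IH] z /=; first by rewrite raddf0.
by rewrite !IH kmapD kmapN kmapZ.
Qed.

Lemma kd_kmap_trunc (T : finType) (dg : T -> nat) e r (z : kz (fvec T) r) : (r <= n)%N ->
  kd (kmap (trunc dg e) z) = kmap (trunc dg (e + 1)) (kd z).
Proof.
have kmapN e' s (y : kz (fvec T) s) : kmap (trunc dg e') (- y) = - kmap (trunc dg e') y.
  by rewrite -sub0r kmapB kmap0 ?sub0r ?raddf0.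
have kmapD e' s (y y' : kz (fvec T) s) :
    kmap (trunc dg e') (y + y') = kmap (trunc dg e') y + kmap (trunc dg e') y'.
  by rewrite -[y' in LHS]opprK kmapB kmapN opprK.
have kmapZ s j (y : kz (fvec T) s) : (j < n)%N ->
    kmap (trunc dg (e + 1)) (x_ j *: y) = x_ j *: kmap (trunc dg e) y.
  by move=> hj; elim: s y => [|s IH] y /=; rewrite ?IH // (trunc_homogZ _ _ _ (xpow_homog _ _ hj)).
elim: r z => [|r IH] z hr /=; first by rewrite raddf0.
by rewrite !IH ?(ltnW hr) // kmapD kmapN kmapZ.
Qed.

Section FreeExactness.
Variable T : finType.
Let any (u : fvec T) := True.

Lemma boundary_pos0 r (u : fvec T) : (r <= n)%N -> vJ 1 r u ->
  exists2 w, kin any 1 w & kd w = k0 r u.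
Proof.
elim: r u => [|r IH] u hr hu /=.
  by exists 0 => //; rewrite (vJ_r0 hu).
have [|w _ hw] := @vJ_split _ _ _ predT _ _ _ hr hu; first by move=> i.
have [y hy e] := IH _ (ltnW hr) hw.
exists (y, k0 r w) => /=; first by split => //; apply: k0_kin.
by rewrite e kd_k0 oppr0 -k0Z -raddfD /= subrK.
Qed.

Lemma boundary_pos0_inv r (u : fvec T) w : (r <= n)%N -> kin any 1 w -> kd w = k0 r u -> vJ 1 r u.
Proof.
elim: r u w => [|r IH] u w hr /=; first by move=> _ <-; apply: vJ_0.
case: w => a b [/= ha /kin_k0 [w _ ->]] [e _].
rewrite -(subrK (x_ r *: w) u); apply: vJ_D; last exact: vJ_xpow.
apply: vJ_le (leqnSn _) _; apply: IH (ltnW hr) ha _.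
by rewrite raddfB /= k0Z -e addrK.
Qed.

(** The mapping cone reduces to fewer variables by induction, except in position 1: there the second
    component has position 0, and it bounds because [x_r] is regular modulo the earlier
    variables. *)
Lemma koszul_exact r i (z : kz (fvec T) r) : (r <= n)%N -> kin any i.+1 z -> kd z = 0 ->
  exists2 w, kin any i.+2 w & kd w = z.
Proof.
have a0 : any 0 by []. have aB u v : any u -> any v -> any (u - v) by [].
elim: r i z => [|r IH] i /=; first by move=> z _ -> _; exists 0.
case=> a b hr [/= ha hb] [ea /eqP]; rewrite oppr_eq0 => /eqP eb.
have [w hw ew] : exists2 w, kin any i.+1 w & kd w = b.
  case: i ha hb => [|i] ha hb; last exact: IH (ltnW hr) _ _.
  have [u _ eu] := kin_k0 hb; rewrite eu; apply: (boundary_pos0 (ltnW hr)).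
  apply: (@vJ_reg _ _ _ 1 1); apply: (boundary_pos0_inv (ltnW hr) (w := - a)).
    exact: kinN.
  by rewrite kdN k0Z -eu; apply/eqP; rewrite eq_sym -addr_eq0 addrC ea.
have ha' : kin any i.+1 (a + x_ r *: w) by apply: kinD => //; apply: kin_scale hw.
have [|y hy ey] := IH _ _ (ltnW hr) ha'; first by rewrite raddfD /= kdZ ew.
exists (y, - w) => /=; first by split => //; apply: kinN.
by rewrite ey kdN opprK ew scalerN addrK.
Qed.

End FreeExactness.

Definition fproj (T : finType) (A : pred T) (u : fvec T) : fvec T :=
  [ffun i => if A i then u i else 0].

Lemma fproj_is_linear (T : finType) (A : pred T) : linear (@fproj T A).
Proof.
move=> a u v; apply/ffunP => i; rewrite !(ffunE, fvE) .
by case: ifP => // _; rewrite mulr0 addr0.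
Qed.
HB.instance Definition _ T A :=
  GRing.isLinear.Build P (fvec T) (fvec T) _ (@fproj T A) (@fproj_is_linear T A).

Lemma fproj_supp (T : finType) (A : pred T) u : supp A (fproj A u).
Proof. by move=> i /negbTE hi; rewrite ffunE hi. Qed.

Lemma fproj_id (T : finType) (A : pred T) u : supp A u -> fproj A u = u.
Proof. by move=> h; apply/ffunP => i; rewrite ffunE; case: ifPn => // /h. Qed.

Section GradedFree.
Variables (T : finType) (dg : T -> nat) (A : pred T).
Let F e (u : fvec T) := supp A u /\ above dg e u.

(** Projection to the support and truncation both commute with [kd], so any preimage can be refined.
    The thresholds differ by one because coefficients are measured without the degree 1 carried by
    each Koszul generator. *)
Let refine r i e (z w : kz (fvec T) r) : (r <= n)%N -> kin (F (e + 1)) i z ->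
  kin (fun _ => True) i.+1 w -> kd w = z -> exists2 w', kin (F e) i.+1 w' & kd w' = z.
Proof.
move=> hr hz hw e1; exists (kmap (trunc dg e) (kmap (fproj A) w)).
  rewrite kmap_comp; apply: kin_kmap hw; first by rewrite /= raddf0; apply: raddf0.
  by move=> u _; split; [apply/supp_trunc/fproj_supp | apply: above_trunc].
rewrite kd_kmap_trunc // kd_kmap e1.
have -> : kmap (fproj A) z = z.
  by rewrite -[RHS]kmap_id; apply: kmap_eq hz; rewrite ?raddf0 // => u [/fproj_id].
rewrite -[RHS]kmap_id; apply: kmap_eq hz => [u [_] //||//]; exact: raddf0.
Qed.

Lemma koszul_exact_graded r i e (z : kz (fvec T) r) : (r <= n)%N ->
  kin (F (e + 1)) i.+1 z -> kd z = 0 -> exists2 w, kin (F e) i.+2 w & kd w = z.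
Proof.
move=> hr hz e1; have hz' : kin (fun _ => True) i.+1 z by apply: kin_sub hz.
by have [w hw ew] := koszul_exact hr hz' e1; apply: refine hw ew.
Qed.

Lemma boundary_pos0_graded r e u : (r <= n)%N -> F (e + 1) u -> vJ 1 r u ->
  exists2 w, kin (F e) 1 w & kd w = k0 r u.
Proof.
move=> hr hu e1; have [w hw ew] := boundary_pos0 hr e1; apply: refine hw ew => //.
exact: k0_kin.
Qed.

End GradedFree.

(* Vanishing of the Koszul homology [H_i(x; Z)] in degrees above [c + i]. *)
Definition kvan (T : finType) (dg : T -> nat) (Z : fvec T -> Prop) (i : nat) (c : int) :=
  forall z : kz (fvec T) n, kin (fun u => Z u /\ above dg c u) i z -> kd z = 0 ->
  exists2 w, kin Z i.+1 w & kd w = z.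

End Koszul.

(** * Koszul homology of the cycles of a complex that is exact in high degrees *)

Section KoszulVanishing.
Variables (K : fieldType) (n : nat).
Local Notation P := {mpoly K[n]}.
Local Notation fvec := (@fvec K n).

Section Zigzag.
Variables (B : nat -> finType) (dg : forall k, B k -> nat) (A : forall k, pred (B k)).
Variable d : forall k, {linear fvec (B k.+1) -> fvec (B k)}.
Hypothesis d_supp : forall k u, supp (@A k.+1) u -> supp (@A k) (d k u).
Hypothesis dd0 : forall k u, supp (@A k.+2) u -> d k (d k.+1 u) = 0.
Hypothesis d_graded : forall k, graded_map (@dg k.+1) (@dg k) (d k).
Variable c : int.
Hypothesis dg_le : forall k (b : B k.+2), A b -> (dg b)%:Z <= c + k%:Z.
Hypothesis vanish : forall k (v : fvec (B k.+1)), supp (@A k.+1) v ->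
  above (@dg k.+1) (c + k%:Z - 1) v -> d k v = 0 ->
  exists2 w, supp (@A k.+2) w & d k.+1 w = v.

(** In the relevant degrees the cycles in position [k + 1] are a quotient of the free module in
    position [k + 2] by its cycles. Free modules have no higher Koszul homology, so the connecting
    map trades [i] for [i - 1] and [k] for [k + 1], and the total degree [c + k + i] is
    unchanged. *)
Lemma kvan_cycles i k :
  kvan (@dg k.+1) (fun u => supp (@A k.+1) u /\ d k u = 0) i (c + k%:Z).
Proof.
pose N k (u : fvec (B k.+1)) := supp (@A k.+1) u /\ d k u = 0.
pose F k e (u : fvec (B k.+2)) := supp (@A k.+2) u /\ above (@dg k.+2) e u.
have F0 k' e : F k' e 0 by split; [exact: supp0 | exact: above0].
have FB k' e u v : F k' e u -> F k' e v -> F k' e (u - v).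
  move=> [h1 h2] [h3 h4]; split; first exact: suppB.
  by apply: aboveD => //; apply: aboveN.
have lift k' j z : kin (fun u => N k' u /\ above (@dg k'.+1) (c + k'%:Z) u) j z ->
    exists2 y : kz (fvec (B k'.+2)) n, kin (F k' (c + k'%:Z)) j y & kmap (d k'.+1) y = z.
  apply: kin_lift; first exact: fmap0.
  move=> u [[hs hd0] hab].
  have [|w hw ew] := vanish hs _ hd0; first by apply: above_le hab; lia.
  exists (trunc (@dg k'.+2) (c + k'%:Z) w); last by rewrite d_graded ew.
  by split; [apply: supp_trunc | apply: above_trunc].
elim: i k => [|i IH] k z /lift [y hy ey] hd.
  (* For [i = 0] the element has degree above [c + k] over generators of degree at most [c + k], so
     its coefficients have no constant term. *)
  have [u hF eu] := kin_k0 hy.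
  have hJ : vJ 1 n u.
    case: hF => hs hab; apply: (@vJ_top _ _ _ (@dg k.+2) (@A k.+2) 1 (c + k%:Z)) => //; first exact: dg_le.
    by rewrite /= muln0 addr0.
  have hF' : F k (c + k%:Z - 1 + 1) u by rewrite subrK.
  have [w hw ew] := boundary_pos0_graded (leqnn n) hF' hJ.
  exists (kmap (d k.+1) w); last by rewrite kd_kmap ew -eu.
  by apply: kin_kmap hw; [exact: fmap0 | move=> v [hv _]; split; [exact: d_supp | exact: dd0]].
(* [kd y] represents the image of [z] under the connecting map; its threshold rises by one because
   [kd] multiplies by variables. *)
have hdy : kin (fun u => N k.+1 u /\ above (@dg k.+2) (c + k.+1%:Z) u) i (kd y).
  have h1 : kin (F k (c + k.+1%:Z)) i (kd y).
    apply: (kd_kin (F0 k _) (@FB k _) _ (leqnn n) hy) => j u hj [h1 h2]; split; first exact: suppZ.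
    have -> : c + k.+1%:Z = c + k%:Z + 1 by lia.
    by apply: above_homogZ => //; apply: xpow_homog.
  have h2 : kmap (d k.+1) (kd y) = 0 by rewrite -kd_kmap ey.
  have h3 := kin_ker h1 h2.
  by apply: kin_sub h3 => u [[? ?] ?].
have [y' hy' ey'] := IH k.+1 (kd y) hdy (kd_kd y).
(* [y - y'] is a Koszul cycle over a free module, hence a boundary, and still maps to [z] because
   [d] kills [y']. *)
have hs : kin (fun u => supp (@A k.+2) u) i.+1 (y - y').
  have QB (u v : fvec _) : supp (@A k.+2) u -> supp (@A k.+2) v -> supp (@A k.+2) (u - v).
    exact: suppB.
  have hy1 : kin (fun u => supp (@A k.+2) u) i.+1 y by apply: kin_sub hy => u [].
  by apply: (kinB QB hy1); apply: kin_sub hy' => u [].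
have hs' : kin (fun _ => True) i.+1 (y - y') by apply: kin_sub hs.
have [|w hw ew] := koszul_exact (leqnn n) hs'; first by rewrite kdB ey' subrr.
exists (kmap (d k.+1) (kmap (fproj (@A k.+2)) w)).
  rewrite kmap_comp; apply: kin_kmap hw; first by rewrite /= raddf0 fmap0.
  by move=> u _; split; [apply: d_supp | apply: dd0]; apply: fproj_supp.
rewrite kd_kmap kd_kmap ew.
have -> : kmap (fproj (@A k.+2)) (y - y') = y - y'.
  by rewrite -[RHS]kmap_id; apply: kmap_eq hs; rewrite ?raddf0 // => u /fproj_id.
rewrite kmapB ey (kmap_eq0 (fmap0 _) _ hy') ?subr0 // => u []; exact.
Qed.
End Zigzag.
End KoszulVanishing.

(** * From Koszul homology to graded free resolutions *)

(** [U] is an arbitrary predicate, so rows are adjoined classically as long as some vector of [U]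
    escapes; each one raises the rank, which is at most [N]. *)
Lemma subspace_row_basis (K : fieldType) (N : nat) (U : 'rV[K]_N -> Prop) :
  exists k (A : 'M[K]_(k, N)), (forall i, U (row i A)) /\ forall v, U v -> (v <= A)%MS.
Proof.
suff main b k (A : 'M[K]_(k, N)) : (N - \rank A <= b)%N -> (forall i, U (row i A)) ->
    exists k (A : 'M[K]_(k, N)), (forall i, U (row i A)) /\ forall v, U v -> (v <= A)%MS.
  by apply: (main N 0%N 0) => [|[]//]; rewrite leq_subr.
elim: b k A => [|b IH] k A hb hA.
  exists k, A; split=> // v _; apply: submx_full; rewrite -col_leq_rank.
  by rewrite leqn0 subn_eq0 in hb.
have [h|/not_all_ex_not [v hv]] := classic (forall v, U v -> (v <= A)%MS); first by exists k, A.
have [hU /negP hvA] := imply_to_and _ _ hv.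
apply: (IH _ (col_mx A v)); last first.
  move=> i; rewrite -[i]splitK; case: split => j /=; first by rewrite rowKu.
  by rewrite rowKd [j]ord1 (_ : row 0 v = v) //; apply/rowP => l; rewrite mxE.
have : (\rank A < \rank (col_mx A v))%N.
  rewrite -(addsmxE A v); apply: rank_ltmx.
  by rewrite ltmxE addsmxSl /= addsmx_sub submx_refl.
by lia.
Qed.

Section Resolutions.
Variables (K : fieldType) (n : nat).
Local Notation P := {mpoly K[n]}.
Local Notation fvec := (@fvec K n).
Local Notation x_ r := (xpow K n 1 r).

(** Closure under truncation gives closure under homogeneous components, these being differences of
    two truncations. *)
Definition graded_submodule (T : finType) (dg : T -> nat) (Z : fvec T -> Prop) :=
  [/\ Z 0, (forall u v, Z u -> Z v -> Z (u - v)), (forall a u, Z u -> Z (a *: u)) &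
      (forall e u, Z u -> Z (trunc dg e u))].

Lemma gsubD (T : finType) (dg : T -> nat) (Z : fvec T -> Prop) u v :
  graded_submodule dg Z -> Z u -> Z v -> Z (u + v).
Proof.
case=> Z0 ZB ZZ _ hu hv; have -> : u + v = u - (-1) *: v by rewrite scaleN1r opprK.
by apply: ZB => //; apply: ZZ.
Qed.

Lemma gsub_sum (T : finType) (dg : T -> nat) (Z : fvec T -> Prop) I
  (r : seq I) (Q : pred I) (F : I -> fvec T) :
  graded_submodule dg Z -> (forall i, Q i -> Z (F i)) -> Z (\sum_(i <- r | Q i) F i).
Proof.
move=> hZ hF; apply: (big_ind Z) => //; first by case: hZ.
by move=> u v; apply: gsubD hZ.
Qed.

Definition hcomp (T : finType) (dg : T -> nat) (d : int) (u : fvec T) : fvec T :=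
  trunc dg (d - 1) u - trunc dg d u.

Definition vhomog (T : finType) (dg : T -> nat) (d : nat) (v : fvec T) :=
  forall i, v i = 0 \/ ((dg i <= d)%N /\ v i \is (d - dg i)%N.-homog).

Section Components.
Variables (T : finType) (dg : T -> nat).
Implicit Types u v : fvec T.

Lemma hcomp_coef d u i m :
  (hcomp dg d u i)@_m = if (mdeg m + dg i)%N%:Z == d then (u i)@_m else 0.
Proof.
rewrite !fvE !ffunE mcoeffB !mcoeff_tr.
by case: eqP => h; case: ifP => h1; case: ifP => h2; rewrite ?subrr ?subr0 //; lia.
Qed.

Lemma hcompP d u i m : (hcomp dg d u i)@_m != 0 -> (mdeg m + dg i)%N%:Z = d.
Proof. by rewrite hcomp_coef; case: ifP => [/eqP //|_]; rewrite eqxx. Qed.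

Lemma hcomp0 d : hcomp dg d 0 = 0.
Proof.
by apply/ffunP => i; apply/mpolyP => m; rewrite hcomp_coef fvE mcoeff0 if_same.
Qed.

Lemma hcomp_vhomog (d : nat) u : vhomog dg d (hcomp dg d u).
Proof.
move=> i; case: (leqP (dg i) d) => h.
  by right; split => //; apply/dhomogP => m; rewrite mcoeff_msupp => /hcompP /= ; lia.
left; apply/mpolyP => m; rewrite mcoeff0; apply/eqP/negPn/negP => /hcompP; lia.
Qed.

Lemma hcomp_neg d u : d < 0 -> hcomp dg d u = 0.
Proof.
move=> h; apply/ffunP => i; apply/mpolyP => m; rewrite fvE mcoeff0.
by apply/eqP/negPn/negP => /hcompP; lia.
Qed.

Lemma hcomp_id (d : nat) u : vhomog dg d u -> hcomp dg d u = u.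
Proof.
move=> h; apply/ffunP => i; apply/mpolyP => m; rewrite hcomp_coef; case: eqP => // hd.
have [->|[h1 /dhomogP h2]] := h i; first by rewrite mcoeff0.
apply/eqP; rewrite eq_sym; apply/negPn/negP; rewrite -mcoeff_msupp => /h2 /= h3.
by apply: hd; lia.
Qed.

Lemma hcomp_above d u : above dg (d - 1) (hcomp dg d u).
Proof. by apply/aboveP => i m /hcompP ->; lia. Qed.

Lemma hcompZ d (k : nat) a u : a \is k.-homog ->
  hcomp dg (d + k%:Z) (a *: u) = a *: hcomp dg d u.
Proof.
move=> ha; rewrite /hcomp addrAC !trunc_homogZ // scalerBr.
by congr (_ - _).
Qed.

Lemma hcomp_sum d I (r : seq I) (F : I -> fvec T) :
  hcomp dg d (\sum_(i <- r) F i) = \sum_(i <- r) hcomp dg d (F i).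
Proof. by rewrite sumrB -!raddf_sum. Qed.

Lemma hcomp_partition u : exists D : nat, u = \sum_(0 <= d < D) hcomp dg d%:Z u.
Proof.
have tele (D : nat) : u - trunc dg (D%:Z - 1) u = \sum_(0 <= d < D) hcomp dg d%:Z u.
  elim: D => [|D IH].
    rewrite big_geq // (_ : trunc _ _ _ = u) ?subrr //.
    by apply/aboveP => i m _; lia.
  rewrite big_nat_recr //= -IH /hcomp addrA subrK.
  by congr (_ - trunc _ _ _); lia.
exists (\max_i (msize (u i) + dg i))%N; rewrite -tele.
rewrite (_ : trunc _ _ _ = 0) ?subr0 //.
apply/ffunP => i; rewrite ffunE fvE; apply: tr_eq0 => m /mcoeff_msize hm.
have := @leq_bigmax _ (fun i => (msize (u i) + dg i)%N) i; lia.
Qed.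

Lemma gsub_hcomp (Z : fvec T -> Prop) d u : graded_submodule dg Z -> Z u -> Z (hcomp dg d u).
Proof. by case=> _ ZB _ Zt hu; apply: ZB; apply: Zt. Qed.

End Components.

Lemma graded_hcomp (T T' : finType) (dg : T -> nat) (dg' : T' -> nat)
  (f : {linear fvec T -> fvec T'}) d u : graded_map dg dg' f ->
  f (hcomp dg d u) = hcomp dg' d (f u).
Proof. by move=> hf; rewrite /hcomp fmapB !hf. Qed.

Definition lapp (T : finType) r (g : 'I_r -> fvec T) (u : fvec 'I_r) : fvec T :=
  \sum_p u p *: g p.

Lemma lapp_is_linear (T : finType) r (g : 'I_r -> fvec T) : linear (lapp g).
Proof.
move=> a u v; rewrite /lapp scaler_sumr -big_split /=; apply: eq_bigr => p _.
by rewrite !fvE scalerDl scalerA.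
Qed.
HB.instance Definition _ (T : finType) r (g : 'I_r -> fvec T) :=
  GRing.isLinear.Build P (fvec 'I_r) (fvec T) _ (lapp g) (@lapp_is_linear T r g).

Lemma lapp_graded (T : finType) (dg : T -> nat) r (g : 'I_r -> fvec T) (dgp : 'I_r -> nat) :
  (forall p, vhomog dg (dgp p) (g p)) -> graded_map dgp dg (lapp g).
Proof.
move=> hg e u; apply/ffunP => i; rewrite ffunE !fv_sumE raddf_sum /=.
apply: eq_bigr => p _; rewrite !fvE ffunE.
have [->|[h1 h2]] := hg p i; first by rewrite !mulr0 raddf0.
by rewrite -(tr_mul_homog _ _ h2); congr tr; lia.
Qed.

Definition generates (T : finType) (dg : T -> nat) (Z : fvec T -> Prop) (c : int) r
    (dgp : 'I_r -> nat) (g : 'I_r -> fvec T) :=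
  [/\ (forall p, vhomog dg (dgp p) (g p)), (forall p, Z (g p)), (forall p, (dgp p)%:Z <= c) &
      (forall v, Z v -> exists u, v = lapp g u)].

Lemma kin1_sum (T : finType) (Z : fvec T -> Prop) r (w : kz (fvec T) r) u : Z 0 ->
  kin Z 1 w -> kd w = k0 r u -> exists2 W : nat -> fvec T,
    (forall j, Z (W j)) & u = \sum_(j < r) x_ j *: W j.
Proof.
move=> Z0; elim: r w u => [|r IH] w u /=.
  by move=> _ <-; exists (fun _ => 0) => //; rewrite big_ord0.
case: w => a b [/= ha /kin_k0 [w hw ->]] [e _].
have [|W hW eW] := IH a (u - x_ r *: w) ha; first by rewrite raddfB /= k0Z -e addrK.
exists (fun j => if j == r then w else W j); first by move=> j; case: eqP.
rewrite big_ord_recr /= eqxx -[LHS](subrK (x_ r *: w)) eW; congr (_ + _).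
by apply: eq_bigr => j _; rewrite ltn_eqF.
Qed.

Section OneModule.
Variables (T : finType) (dg : T -> nat) (Z : fvec T -> Prop) (c : int).
Hypothesis hZ : graded_submodule dg Z.
Hypothesis hK0 : kvan dg Z 0 c.

Lemma kvan0_sum c' u : kvan dg Z 0 c' -> Z u -> above dg c' u -> exists2 W : nat -> fvec T,
  (forall j, Z (W j)) & u = \sum_(j < n) x_ j *: W j.
Proof.
move=> h hu ha; have [|w hw ew] := h (k0 n u) _ (kd_k0 _ _); first exact: k0_kin.
by apply: kin1_sum hw ew; case: hZ.
Qed.

(** The coefficients at monomials of degree at most [d] determine an element homogeneous of degree
    [d], so [phi] reduces the claim to finitely many coordinates over [K]. *)
Lemma component_generators (d : nat) : exists r (g : 'I_r -> fvec T),
  (forall p, vhomog dg d (g p) /\ Z (g p)) /\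
  forall u, Z u -> vhomog dg d u -> exists a : 'I_r -> P, u = \sum_p a p *: g p.
Proof.
pose X : finType := (T * 'X_{1..n < d.+1})%type.
pose phi (u : fvec T) : 'rV[K]_#|X| := \row_(k < #|X|) (fun x : X => (u x.1)@_x.2) (enum_val k).
have phi_inj u v : vhomog dg d u -> vhomog dg d v -> phi u = phi v -> u = v.
  move=> hu hv /rowP e; apply/ffunP => i; apply/mpolyP => m.
  case: (ltnP (mdeg m) d.+1) => hm.
    by have := e (enum_rank (i, BMultinom hm)); rewrite !mxE enum_rankK.
  rewrite -(hcomp_id hu) -(hcomp_id hv) !hcomp_coef ifF; last by lia.
  by rewrite ifF //; lia.
have [k [A [hA hU]]] := subspace_row_basis (fun r => exists2 u, Z u /\ vhomog dg d u & phi u = r).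
have [g hg] : exists g : 'I_k -> fvec T, forall i, (Z (g i) /\ vhomog dg d (g i)) /\ phi (g i) = row i A.
  by apply: (fin_all_exists (P := fun i (u : fvec T) => (Z u /\ vhomog dg d u) /\ phi u = row i A)) => i;
     have [u hu e] := hA i; exists u.
exists k, g; split=> [p|u hu hd]; first by case: (hg p) => -[].
have /submxP [D eD] := hU (phi u) (ex_intro2 _ _ u (conj hu hd) erefl).
exists (fun p => (D 0 p)%:MP); apply: phi_inj => //.
  move=> i; rewrite fv_sumE.
  have [h|h] := leqP (dg i) d.
    right; split => //; apply: rpred_sum => p _; rewrite fvE mul_mpolyC; apply: dhomogZ.
    by have [[_ /(_ i) [->|[]//]] _] := hg p; rewrite dhomog0.
  left; apply: big1 => p _; rewrite fvE.
  have [[_ /(_ i) [->|[h' _]]] _] := hg p; first by rewrite mulr0.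
  by rewrite leqNgt h in h'.
rewrite eD; apply/rowP => l; rewrite !mxE fv_sumE raddf_sum /=; apply: eq_bigr => p _.
have [_ /rowP /(_ l)] := hg p; rewrite !mxE => <-.
by rewrite fvE mul_mpolyC mcoeffZ.
Qed.

(** Finite generation comes out without the basis theorem: the components up to degree [c] are
    finite-dimensional, and beyond [c] the vanishing of [H_0] makes each component the product of
    the variables with the previous one. *)
Lemma kvan_generators : exists r (dgp : 'I_r -> nat) (g : 'I_r -> fvec T), generates dg Z c dgp g.
Proof.
have hfam (D : nat) : D%:Z <= c + 1 -> exists r (dgp : 'I_r -> nat) (g : 'I_r -> fvec T),
  [/\ (forall p, vhomog dg (dgp p) (g p)), (forall p, Z (g p)), (forall p, (dgp p)%:Z <= c) &
    forall d u, (d < D)%N -> Z u -> vhomog dg d u -> exists a, u = lapp g a].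
  elim: D => [|D IH] hD.
    by exists 0%N, (fun _ => 0%N), (fun _ => 0); split => [[]|[]|[]|].
  have [|r [dgp [g [h1 h2 h3 h4]]]] := IH; first by lia.
  have [r' [g' [h5 h6]]] := component_generators D.
  exists (r + r')%N, (fun p => if split p is inl q then dgp q else D),
    (fun p => match split p with inl q => g q | inr q => g' q end); split.
  - by move=> p; case: split => // q; case: (h5 q).
  - by move=> p; case: split => // q; case: (h5 q).
  - by move=> p; case: split => // q; lia.
  move=> d u; rewrite ltnS leq_eqVlt => /orP[/eqP -> hu hd|hdD hu hd].
    have [a ea] := h6 u hu hd.
    exists [ffun p => if split p is inr q then a q else 0].
    rewrite /lapp big_split_ord /= big1 ?add0r.
      by rewrite ea; apply: eq_bigr => p _; rewrite ffunE (unsplitK (inr p)).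
    by move=> p _; rewrite ffunE (unsplitK (inl p)) scale0r.
  have [a ea] := h4 d u hdD hu hd.
  exists [ffun p => if split p is inl q then a q else 0].
  rewrite /lapp big_split_ord /= addrC big1 ?add0r.
    by rewrite ea; apply: eq_bigr => p _; rewrite ffunE (unsplitK (inl p)).
  by move=> p _; rewrite ffunE (unsplitK (inr p)) scale0r.
have [r [dgp [g [h1 h2 h3 h4]]]] : exists r (dgp : 'I_r -> nat) (g : 'I_r -> fvec T),
  [/\ (forall p, vhomog dg (dgp p) (g p)), (forall p, Z (g p)), (forall p, (dgp p)%:Z <= c) &
    forall (d : nat) u, d%:Z <= c -> Z u -> vhomog dg d u -> exists a, u = lapp g a].
  have [hc|hc] := lerP 0 (c + 1).
    have [|r [dgp [g [h1 h2 h3 h4]]]] := hfam (absz (c + 1)); first by lia.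
    by exists r, dgp, g; split=> // d u hd; apply: h4; lia.
  by exists 0%N, (fun _ => 0%N), (fun _ => 0); split => [[]|[]|[]|d u hd] //; lia.
exists r, dgp, g; split => // v hv.
have main (d : nat) u : Z u -> exists a, hcomp dg d%:Z u = lapp g a.
  elim: d u => [|d IH] u hu; have hhu e : Z (hcomp dg e u) by apply: gsub_hcomp hZ hu.
    have [hc|hc] := lerP 0 c; first by apply: (h4 0%N) => //; exact: hcomp_vhomog.
    have [|W hW e] := kvan0_sum hK0 (hhu 0%:Z).
      by apply: above_le (hcomp_above _ _ _); lia.
    exists 0; rewrite fmap0 -(hcomp_id (hcomp_vhomog dg 0 u)) e hcomp_sum big1 // => j _.
    rewrite (_ : 0%:Z = (-1) + 1%:Z) // (hcompZ _ _ _ (xpow_homog _ _ (ltn_ord j))).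
    by rewrite hcomp_neg // scaler0.
  have [hc|hc] := lerP d.+1%:Z c; first by apply: (h4 d.+1) => //; exact: hcomp_vhomog.
  have [|W hW e] := kvan0_sum hK0 (hhu d.+1%:Z).
    by apply: above_le (hcomp_above _ _ _); lia.
  have [a ha] : exists a : 'I_n -> fvec 'I_r, forall j : 'I_n, hcomp dg d%:Z (W j) = lapp g (a j).
    by apply: (fin_all_exists (P := fun (j : 'I_n) a => hcomp dg d%:Z (W j) = lapp g a)) => j; apply: IH.
  exists (\sum_(j : 'I_n) x_ j *: a j).
  rewrite -(hcomp_id (hcomp_vhomog dg d.+1 u)) e hcomp_sum raddf_sum; apply: eq_bigr => j _.
  rewrite (_ : d.+1%:Z = d%:Z + 1%:Z) ?(hcompZ _ _ _ (xpow_homog _ _ (ltn_ord j))); last by lia.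
  by rewrite ha [RHS]fmapZ.
have [D ->] := hcomp_partition dg v.
elim: D => [|D [a ea]]; first by rewrite big_geq //; exists 0; rewrite fmap0.
rewrite big_nat_recr //= ea; have [b ->] := main D v hv.
by exists (a + b); rewrite fmapD.
Qed.

End OneModule.

(** * Minimal generators and syzygies *)

Section Syzygies.
Variables (T : finType) (dg : T -> nat) (Z : fvec T -> Prop) (c : int).
Hypothesis hZ : graded_submodule dg Z.

(** The component of the syzygy in degree [dgp p] has a nonzero scalar as coefficient at [p], so it
    can be solved for [g p]. *)
Lemma remove_generator r (dgp : 'I_r.+1 -> nat) (g : 'I_r.+1 -> fvec T) u p :
  generates dg Z c dgp g -> lapp g u = 0 -> (u p)@_0%MM != 0 ->
  generates dg Z c (dgp \o lift p) (g \o lift p).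
Proof.
case=> h1 h2 h3 h4 hu hp; split=> //= v /h4 [w ->].
set a := (u p)@_0%MM in hp.
pose u' := hcomp dgp (dgp p)%:Z u.
have eu' : u' p = a%:MP.
  apply/mpolyP => m; rewrite hcomp_coef mcoeffC.
  have -> : ((mdeg m + dgp p)%N == dgp p :> int) = (m == 0%MM) by rewrite -mdeg_eq0; lia.
  by case: eqP => [->|]; rewrite ?mulr1 ?mulr0.
have : lapp g u' = 0.
  have -> := graded_hcomp (dgp p)%:Z u (lapp_graded h1).
  by rewrite /= hu hcomp0.
rewrite /lapp; clearbody u'; rewrite (bigD1_ord p) //= eu' => /eqP; rewrite addr_eq0 => /eqP e.
exists [ffun j => w (lift p j) - (a^-1)%:MP * w p * u' (lift p j)].
rewrite (bigD1_ord p) //=.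
have -> : w p *: g p = - \sum_j ((a^-1)%:MP * w p * u' (lift p j)) *: g (lift p j).
  under eq_bigr do rewrite -scalerA.
  rewrite -scaler_sumr -scalerN -e scalerA; congr (_ *: _).
  by rewrite mulrC mulrA -mpolyCM divff // mul1r.
rewrite addrC -sumrB; apply: eq_bigr => j _.
by rewrite ffunE scalerBl.
Qed.

Lemma minimal_kvan_generators : kvan dg Z 0 c ->
  exists r (dgp : 'I_r -> nat) (g : 'I_r -> fvec T),
    generates dg Z c dgp g /\ forall u, lapp g u = 0 -> vJ 1 n u.
Proof.
move=> /(kvan_generators hZ) [r]; elim: r => [|r IH] [dgp [g hg]].
  by exists 0%N, dgp, g; split => // u _ [].
have [h|/not_all_ex_not [u hu']] := classic (forall u, lapp g u = 0 -> vJ 1 n u).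
  by exists r.+1, dgp, g.
have [hu hJ] := imply_to_and _ _ hu'.
have [p hp] : exists p, (u p)@_0%MM != 0.
  apply: NNPP => /not_ex_all_not h; apply: hJ => p; apply: inJ1_top.
  by apply/eqP/negPn/negP => hp; apply: (h p).
by apply: IH; exists (dgp \o lift p), (g \o lift p); apply: remove_generator hu hp.
Qed.

Variables (r : nat) (dgp : 'I_r -> nat) (g : 'I_r -> fvec T).
Hypothesis hg : generates dg Z c dgp g.

Lemma syzygies_graded : graded_submodule dgp (fun u => lapp g u = 0).
Proof.
case: hg => h1 _ _ _; split.
- exact: fmap0.
- by move=> u v e1 e2; rewrite fmapB /= e1 e2 subrr.
- by move=> a u e; rewrite fmapZ /= e scaler0.
- by move=> e u e1; rewrite (lapp_graded h1) e1 raddf0.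
Qed.

(** A cycle of the syzygy module bounds over the free module and so comes from [H_(i+1)(x; Z)] by
    the connecting map. For [i > 0] this is Koszul exactness; for [i = 0] it needs the syzygies to
    have coefficients without constant term, which minimality supplies. *)
Lemma kvan_syzygies i c' :
  (i = 0%N -> forall u, lapp g u = 0 -> above dgp (c' + 1) u -> vJ 1 n u) ->
  kvan dg Z i.+1 c' -> kvan dgp (fun u => lapp g u = 0) i (c' + 1).
Proof.
case: (hg) => h1 h2 h3 h4 h0 hK z hz hd.
have [y hy ey] : exists2 y : kz (fvec 'I_r) n,
    kin (fun u => supp predT u /\ above dgp c' u) i.+1 y & kd y = z.
  case: i h0 {hK} hz => [|i] h0 hz.
    have [u [hu hab] ->] := kin_k0 hz.
    by apply: boundary_pos0_graded => //; exact: h0.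
  by apply: koszul_exact_graded => //; apply: kin_sub hz => u [].
have hLy : kin (fun u => Z u /\ above dg c' u) i.+1 (kmap (lapp g) y).
  apply: kin_kmap hy; first exact: fmap0.
  move=> u [_ hab]; split; last exact: above_map (lapp_graded h1) hab.
  by apply: (gsub_sum _ hZ) => p _; case: hZ => _ _ ZZ _; apply: ZZ.
have [|w hw ew] := hK _ hLy.
  by rewrite kd_kmap ey; apply: (kmap_eq0 (fmap0 _) _ hz) => u [].
have [w' hw' ew'] : exists2 w' : kz (fvec 'I_r) n, kin (fun _ => True) i.+2 w' & kmap (lapp g) w' = w.
  apply: kin_lift hw; first exact: fmap0.
  by move=> v /h4 [u ->]; exists u.
exists (y - kd w'); last by rewrite kdB kd_kd subr0 ey.
have hk : kin (fun _ => True) i.+1 (y - kd w').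
  apply: kinB => //; first by apply: kin_sub hy.
  by apply: kd_kin hw' => //.
have := kin_ker hk (g := lapp g) _; rewrite kmapB -kd_kmap ew' ew subrr => /(_ erefl).
by apply: kin_sub => u [].
Qed.

End Syzygies.

(** Each substitution raises the degree by one, so [u] lies in arbitrarily high degrees. *)
Lemma graded_nakayama (T : finType) (dg : T -> nat) (Z : fvec T -> Prop) :
  (forall u, Z u -> exists2 W : nat -> fvec T, (forall j, Z (W j)) & u = \sum_(j < n) x_ j *: W j) ->
  forall u, Z u -> u = 0.
Proof.
move=> h u hu; have hab (e : nat) v : Z v -> above dg (e%:Z - 1) v.
  elim: e v => [|e IH] v hv; first by apply/aboveP => i m _; lia.
  have [W hW ->] := h v hv; rewrite /above raddf_sum; apply: eq_bigr => j _ /=.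
  rewrite (_ : e.+1%:Z - 1 = (e%:Z - 1) + 1); last by lia.
  by apply: above_homogZ; [exact: xpow_homog | exact: IH].
apply/ffunP => i; apply/mpolyP => m; rewrite fvE mcoeff0; apply/eqP/negPn/negP => hm.
have /aboveP /(_ i m hm) := hab (mdeg m + dg i).+1 u hu; lia.
Qed.

Lemma reg_le_zero (T : finType) (dg : T -> nat) (M : (T -> P) -> Prop) a :
  (forall v, M v <-> forall i, v i = 0) -> reg_le dg M a.
Proof.
move=> hM; exists (fun _ => 0%N), (fun _ _ => 0%N), (fun _ _ => 0), (fun _ _ _ => 0).
split; first by exists 0%N.
split; first by case.
split; first by move=> i [].
have hcase (J : finType) (A : 'I_0 -> J -> P) v : in_im A v <-> forall j, v j = 0.
  split=> [[u hu] j|h]; first by rewrite hu /lin_app big_ord0.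
  by exists (fun _ => 0) => j; rewrite h /lin_app big_ord0.
split; first by move=> v; rewrite hM hcase.
split; first by move=> u; rewrite hcase; split => [_ []|_ j] //; rewrite /lin_app big_ord0.
split; last by move=> i [].
by move=> i u; rewrite hcase; split => [_ []|_ j] //; rewrite /lin_app big_ord0.
Qed.

Lemma reg_le_glue (T : finType) (dg : T -> nat) (Z : fvec T -> Prop) c r
    (dgp : 'I_r -> nat) (g : 'I_r -> fvec T) :
  graded_submodule dg Z -> generates dg Z c dgp g ->
  reg_le dgp (fun v => lapp g (finfun v) = 0) (c + 1) ->
  reg_le dg (fun v => Z (finfun v)) c.
Proof.
move=> hZ [h1 h2 h3 h4] [r' [dg' [d0' [d' [[k hk] [hd0 [hd [hM [hker0 [hker hdeg]]]]]]]]]].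
pose rr i := if i is j.+1 then r' j else r.
pose dgg i : 'I_(rr i) -> nat :=
  match i return 'I_(rr i) -> nat with 0%N => dgp | j.+1 => dg' j end.
pose dd i : 'I_(rr i.+1) -> 'I_(rr i) -> P :=
  match i return 'I_(rr i.+1) -> 'I_(rr i) -> P with 0%N => d0' | j.+1 => d' j end.
have lappE u j : lapp g (finfun u) j = lin_app (fun p j => g p j) u j.
  by rewrite /lapp fv_sumE; apply: eq_bigr => p _; rewrite fvE ffunE.
exists rr, dgg, (fun p j => g p j), dd.
split; first by exists k.+1; case=> // i; rewrite ltnS => /hk.
split; first by move=> p j; exact: h1.
split; first by case.
split.
  move=> v; split=> [/h4 [u eu]|[u hu]].
    by exists u => j; rewrite -lappE -[v j](ffunE v) eu; congr (lapp g _ j); apply/ffunP => i; rewrite ffunE.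
  rewrite (_ : finfun v = lapp g (finfun u)); last by apply/ffunP => j; rewrite lappE ffunE hu.
  by apply: (gsub_sum _ hZ) => p _; case: hZ => _ _ ZZ _; apply: ZZ.
split.
  move=> u; rewrite -hM; split=> [h|h j]; first by apply/ffunP => j; rewrite lappE h fvE.
  by rewrite -lappE h fvE.
split; first by case.
case=> [p|i p] /=; first by have := h3 p; lia.
by have := hdeg i p; lia.
Qed.

(** The auxiliary [l] bounds the positions with nonzero Koszul homology, in effect the projective
    dimension. It starts at [n], beyond which the Koszul complex has no chains, and drops by one
    with every syzygy module. *)
Theorem reg_le_of_kvan (T : finType) (dg : T -> nat) (Z : fvec T -> Prop) c :
  graded_submodule dg Z -> (forall i, kvan dg Z i c) ->
  reg_le dg (fun v => Z (finfun v)) c.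
Proof.
suff main l (T' : finType) (dg' : T' -> nat) (Z' : fvec T' -> Prop) c' :
    graded_submodule dg' Z' -> (forall i, kvan dg' Z' i c') ->
    (forall i e, (l < i)%N -> kvan dg' Z' i e) ->
    reg_le dg' (fun v => Z' (finfun v)) c'.
  move=> hZ hK; apply: (main n) => // i e hi z hz _; exists 0.
    by apply: kin0; case: hZ.
  by rewrite (kin_gt hi hz) raddf0.
elim: l T' dg' Z' c' => [|l IH] T' dg' Z' c' hZ hK hpd;
    have [r [dgp [g [hg hmin]]]] := minimal_kvan_generators hZ (hK 0%N);
    apply: (reg_le_glue hZ hg); have [h1 h2 h3 h4] := hg.
  have hZ1 := syzygies_graded hg.
  have Z10 u : lapp g u = 0 -> u = 0.
    apply: (@graded_nakayama _ dgp (fun u => lapp g u = 0)) => {}u hu.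
    (* All degrees exceed [-1], so vanishing of [H_0] at this threshold says that every syzygy is a
       combination of variables times syzygies. *)
    apply: (kvan0_sum hZ1 (c' := -1)) => //; last by apply/aboveP => i m _; lia.
    rewrite -[-1](subrK 1); apply: (kvan_syzygies hZ hg); last exact: hpd.
    by move=> _ v /hmin.
  apply: reg_le_zero => v; split=> [/Z10 e i|e].
    by rewrite -[v i](ffunE v) e fvE.
  by rewrite (_ : finfun v = 0) ?fmap0 //; apply/ffunP => i; rewrite ffunE e fvE.
apply: (IH _ dgp (fun u => lapp g u = 0)); first exact: syzygies_graded hg.
- by move=> i; apply: (kvan_syzygies hZ hg) => // _ v /hmin.
- move=> i e hi; rewrite -[e](subrK 1); apply: (kvan_syzygies hZ hg); last exact: hpd.
  by move=> ei; rewrite ei in hi.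
Qed.

End Resolutions.

(** * Tensor products of maps of free modules *)

Section Tensor.
Variables (K : fieldType) (n : nat).
Local Notation P := {mpoly K[n]}.
Local Notation fvec := (@fvec K n).

Definition fcol (B C : finType) (c : C) (u : fvec (B * C)%type) : fvec B := [ffun b => u (b, c)].
Definition frow (B C : finType) (b : B) (u : fvec (B * C)%type) : fvec C := [ffun c => u (b, c)].

Lemma fcol_is_linear (B C : finType) c : linear (@fcol B C c).
Proof. by move=> a u v; apply/ffunP => b; rewrite !(ffunE, fvE). Qed.
HB.instance Definition _ (B C : finType) c :=
  GRing.isLinear.Build P (fvec (B * C)%type) (fvec B) _ (@fcol B C c) (@fcol_is_linear B C c).
Lemma frow_is_linear (B C : finType) b : linear (@frow B C b).
Proof. by move=> a u v; apply/ffunP => c; rewrite !(ffunE, fvE). Qed.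
HB.instance Definition _ (B C : finType) b :=
  GRing.isLinear.Build P (fvec (B * C)%type) (fvec C) _ (@frow B C b) (@frow_is_linear B C b).

Section Maps.
Variables (B B' C C' : finType).
Variables (f : {linear fvec B -> fvec B'}) (g : {linear fvec C -> fvec C'}).

Definition tensl (u : fvec (B * C)%type) : fvec (B' * C)%type := [ffun p => f (fcol p.2 u) p.1].
Definition tensr (u : fvec (B * C)%type) : fvec (B * C')%type := [ffun p => g (frow p.1 u) p.2].

Lemma tensl_is_linear : linear tensl.
Proof.
move=> a u v; apply/ffunP => p; rewrite fvE fvE ![tensl _ p]ffunE.
by rewrite (_ : fcol p.2 (a *: u + v) = a *: fcol p.2 u + fcol p.2 v) ?linearP ?fvE.
Qed.
HB.instance Definition _ :=
  GRing.isLinear.Build P (fvec (B * C)%type) (fvec (B' * C)%type) _ tensl tensl_is_linear.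

Lemma tensr_is_linear : linear tensr.
Proof.
move=> a u v; apply/ffunP => p; rewrite fvE fvE ![tensr _ p]ffunE.
by rewrite (_ : frow p.1 (a *: u + v) = a *: frow p.1 u + frow p.1 v) ?linearP ?fvE.
Qed.
HB.instance Definition _ :=
  GRing.isLinear.Build P (fvec (B * C)%type) (fvec (B * C')%type) _ tensr tensr_is_linear.

Lemma fcol_tensl c u : fcol c (tensl u) = f (fcol c u).
Proof. by apply/ffunP => b; rewrite !ffunE. Qed.

Lemma frow_tensr b u : frow b (tensr u) = g (frow b u).
Proof. by apply/ffunP => c; rewrite !ffunE. Qed.

End Maps.

Lemma fvec_expand (C : finType) (u : fvec C) :
  u = \sum_c u c *: ([ffun c' => (c' == c)%:R] : fvec C).
Proof.
apply/ffunP => c; rewrite fv_sumE (bigD1 c) //= big1 ?addr0 => [|c' hc]; rewrite fvE ffunE.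
  by rewrite eqxx mulr1.
by rewrite eq_sym (negbTE hc) mulr0.
Qed.

Lemma tensC (B B' C C' : finType) (f : {linear fvec B -> fvec B'}) (g : {linear fvec C -> fvec C'})
  (u : fvec (B * C)%type) : tensl f (tensr g u) = tensr g (tensl f u).
Proof.
(* With the matrix [G] of [g], a column of [tensr g u] is a combination of columns of [u], and [f]
   passes through it by linearity. *)
pose G c c' := g [ffun x => (x == c)%:R] c'.
have gE w c' : g w c' = \sum_c w c * G c c'.
  rewrite [w in LHS]fvec_expand raddf_sum fv_sumE; apply: eq_bigr => c _.
  by rewrite /= linearZ fvE.
apply/ffunP => -[b' c']; rewrite ffunE [RHS]ffunE /= gE.
have -> : fcol c' (tensr g u) = \sum_c G c c' *: fcol c u.
  apply/ffunP => b; rewrite ffunE ffunE /= gE fv_sumE; apply: eq_bigr => c _.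
  by rewrite fvE !ffunE mulrC.
rewrite raddf_sum fv_sumE; apply: eq_bigr => c _.
by rewrite /= linearZ fvE mulrC !ffunE.
Qed.

Section Comp.
Variables (B B' B'' C : finType).

Lemma tensl_comp (f : {linear fvec B -> fvec B'}) (f' : {linear fvec B' -> fvec B''})
  (u : fvec (B * C)%type) : tensl f' (tensl f u) = tensl (f' \o f) u.
Proof. by apply/ffunP => p; rewrite !ffunE fcol_tensl. Qed.

End Comp.

Definition tdeg (B C : Type) (h : B -> nat) (k : C -> nat) (p : B * C) := (h p.1 + k p.2)%N.

Lemma tensl_graded (B B' C : finType) dg dg' (dgc : C -> nat) (f : {linear fvec B -> fvec B'}) :
  graded_map dg dg' f -> graded_map (tdeg dg dgc) (tdeg dg' dgc) (tensl f).
Proof.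
move=> hf e u; apply/ffunP => p; rewrite !ffunE.
have -> : fcol p.2 (trunc (tdeg dg dgc) e u) = trunc dg (e - (dgc p.2)%:Z) (fcol p.2 u).
  by apply/ffunP => b; rewrite !ffunE; congr tr; rewrite /tdeg /=; lia.
by rewrite hf ffunE; congr tr; rewrite /tdeg /=; lia.
Qed.

Lemma tensr_graded (B C C' : finType) (dgb : B -> nat) dg dg' (f : {linear fvec C -> fvec C'}) :
  graded_map dg dg' f -> graded_map (tdeg dgb dg) (tdeg dgb dg') (tensr f).
Proof.
move=> hf e u; apply/ffunP => p; rewrite !ffunE.
have -> : frow p.1 (trunc (tdeg dgb dg) e u) = trunc dg (e - (dgb p.1)%:Z) (frow p.1 u).
  by apply/ffunP => b; rewrite !ffunE; congr tr; rewrite /tdeg /=; lia.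
by rewrite hf ffunE; congr tr; rewrite /tdeg /=; lia.
Qed.

(** The sign of the second summand in the differential of a tensor product, turned into an
    operator. *)
Definition ftwist (B : finType) (h : B -> nat) (u : fvec B) : fvec B :=
  [ffun b => (-1) ^+ h b * u b].

Lemma ftwist_is_linear (B : finType) h : linear (@ftwist B h).
Proof. by move=> a u v; apply/ffunP => b; rewrite !(ffunE, fvE); ring. Qed.
HB.instance Definition _ (B : finType) h :=
  GRing.isLinear.Build P (fvec B) (fvec B) _ (@ftwist B h) (@ftwist_is_linear B h).

Lemma ftwist_graded (B : finType) (dg : B -> nat) h : graded_map dg dg (ftwist h).
Proof.
move=> e u; apply/ffunP => b; rewrite !ffunE -signr_odd.
by case: odd; rewrite ?expr1 ?expr0 ?mul1r // !mulN1r raddfN.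
Qed.

End Tensor.

(** * The Koszul complex of a sequence of forms *)

Section Exterior.
Variables (K : fieldType) (n m : nat).
Local Notation P := {mpoly K[n]}.
Local Notation fvec := (@fvec K n).
Local Notation S := {set 'I_m}.
Implicit Types (i j k : 'I_m) (J H : S).

Definition sg i J : P := (-1) ^+ #|[set k in J | (k < i)%N]|.

(* [e_J /\ e_J' = sgn J J' e_(J :|: J')] for disjoint [J] and [J']. *)
Definition sgn J J' : P := \prod_(i in J) sg i J'.

Lemma sg_sq i J : sg i J * sg i J = 1.
Proof. by rewrite /sg -exprMn mulrNN mulr1 expr1n. Qed.

Lemma sgn_sq J J' : sgn J J' * sgn J J' = 1.
Proof. by rewrite /sgn -big_split big1 // => i _; apply: sg_sq. Qed.

Lemma sgU i J J' : [disjoint J & J'] -> sg i (J :|: J') = sg i J * sg i J'.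
Proof.
move=> h; rewrite /sg -exprD; congr (_ ^+ _); rewrite -cardsUI.
have -> : [set k in J | (k < i)%N] :&: [set k in J' | (k < i)%N] = set0.
  apply/setP => k; rewrite !inE; apply/negP => /andP[/andP[h1 _] /andP[h2 _]].
  by have /pred0P /(_ k) /= := h; rewrite h1 h2.
rewrite cards0 addn0; congr #|pred_of_set _|; apply/setP => k; rewrite !inE.
by case: (k \in J); case: (k \in J'); case: (k < i)%N.
Qed.

Lemma sg1 i j : sg i [set j] = if (j < i)%N then -1 else 1.
Proof.
rewrite /sg; have -> : [set k in [set j] | (k < i)%N] = if (j < i)%N then [set j] else set0.
  apply/setP => k; rewrite !inE; case: ifP => h; rewrite !inE.
    by case: eqP => [->|].
  by case: eqP => [->|].
by case: ifP; rewrite ?cards1 ?cards0 ?expr1.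
Qed.

Lemma sgU1 i j J : j \notin J -> sg i (j |: J) = sg i [set j] * sg i J.
Proof. by move=> h; rewrite sgU // disjoints1. Qed.

Lemma sg1_anti i j : i != j -> sg i [set j] = - sg j [set i].
Proof.
move=> h; rewrite !sg1; case: (ltngtP i j) => [||/val_inj e]; rewrite ?opprK //.
by rewrite e eqxx in h.
Qed.

Lemma sgnU1l i J J' : i \notin J -> sgn (i |: J) J' = sg i J' * sgn J J'.
Proof. by move=> h; rewrite /sgn big_setU1. Qed.

Lemma prod_sg1 i J : i \notin J -> \prod_(j in J) sg j [set i] = (-1) ^+ #|J| * sg i J.
Proof.
move=> h; have -> : sg i J = \prod_(j in J) (if (j < i)%N then -1 else 1).
  rewrite -big_mkcondr /= /sg -prodr_const.
  by apply: eq_bigl => k; rewrite inE.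
rewrite -prodr_const -big_split /=; apply: eq_bigr => j hj; rewrite sg1.
case: (ltngtP i j) => [||/val_inj e]; rewrite ?mulr1 ?mulrNN ?mulr1 //.
by rewrite e hj in h.
Qed.

Lemma sgnU1r i J J' : i \notin J -> i \notin J' ->
  sgn J (i |: J') = (-1) ^+ #|J| * sg i J * sgn J J'.
Proof.
move=> h h'; rewrite -prod_sg1 // /sgn -big_split /=; apply: eq_bigr => j hj.
by rewrite sgU1.
Qed.

Variable f : 'I_m -> P.

(** The Koszul differential sorted by target and acting on all exterior powers at once, which avoids
    transport between the types [kbasis t]. *)
Definition kbd (v : fvec S) : fvec S :=
  [ffun J : S => \sum_(i | i \notin J) sg i J * f i * v (i |: J)].

Lemma kbd_is_linear : linear kbd.
Proof.
move=> a u v; apply/ffunP => J; rewrite fvE fvE !ffunE mulr_sumr -big_split /=.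
by apply: eq_bigr => i _; rewrite !(ffunE, fvE); ring.
Qed.
HB.instance Definition _ := GRing.isLinear.Build P (fvec S) (fvec S) _ kbd kbd_is_linear.

Definition wedge i (v : fvec S) : fvec S :=
  [ffun J : S => if i \in J then sg i (J :\ i) * v (J :\ i) else 0].

Lemma wedge_is_linear i : linear (wedge i).
Proof.
move=> a u v; apply/ffunP => J; rewrite fvE fvE !ffunE; by case: ifP => _; ring.
Qed.
HB.instance Definition _ i := GRing.isLinear.Build P (fvec S) (fvec S) _ (wedge i) (wedge_is_linear i).

(** The diagonal has its own hypothesis because in characteristic 2 antisymmetry does not make it
    vanish. *)
Lemma sum_antisym (G : 'I_m -> 'I_m -> P) : (forall i, G i i = 0) ->
  (forall i j, i != j -> G i j = - G j i) -> \sum_i \sum_j G i j = 0.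
Proof.
move=> G0 GN.
have split i : \sum_j G i j = \sum_(j : 'I_m | (j < i)%N) G i j + \sum_(j : 'I_m | (i < j)%N) G i j.
  rewrite (bigID (fun j : 'I_m => (j < i)%N)) /=; congr (_ + _).
  rewrite (bigD1 i) ?ltnn //= G0 add0r; apply: eq_bigl => j.
  by rewrite -leqNgt ltn_neqAle eq_sym andbC.
rewrite (eq_bigr _ (fun i _ => split i)) big_split /=.
rewrite [X in _ + X](exchange_big_dep predT) //= -big_split big1 //= => j _.
rewrite -big_split big1 //= => i hi; rewrite (GN j i) ?addNr //.
by apply: contraTneq hi => ->; rewrite ltnn.
Qed.

Lemma kbd_kbd v : kbd (kbd v) = 0.
Proof.
apply/ffunP => J; rewrite fvE ffunE.
pose G i j := if [&& i \notin J, j \notin J & i != j]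
  then sg i J * f i * (sg j (i |: J) * f j * v (j |: (i |: J))) else 0.
rewrite -[RHS](@sum_antisym G); last 2 first.
- by move=> i; rewrite /G eqxx !andbF.
- move=> i j hij; rewrite /G [j == i]eq_sym hij !andbT [(j \notin J) && _]andbC.
  case: ifP => [/andP[h1 h2]|]; last by rewrite oppr0.
  by rewrite !sgU1 // (sg1_anti hij) setUCA; ring.
rewrite big_mkcond; apply: eq_bigr => i _; rewrite ffunE; case: ifPn => h; last first.
  by rewrite big1 // => j _; rewrite /G (negbTE h).
rewrite mulr_sumr big_mkcond; apply: eq_bigr => j _; rewrite /G h /= in_setU1 negb_or.
by rewrite andbC [j == i]eq_sym.
Qed.

(** Exterior multiplication by [e_i] is a null-homotopy of multiplication by [f i]: the term that
    removes [i] again gives [f i], all others cancel by anticommutation. *)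
Lemma wedge_homotopy i v : kbd (wedge i v) + wedge i (kbd v) = f i *: v.
Proof.
apply/ffunP => J; rewrite fvE fvE ffunE [in X in _ + X]ffunE.
case: ifPn => hi; last first.
  rewrite (bigD1 i) //= big1 ?addr0.
    rewrite ffunE setU11 setU1K // mulrACA -mulrA mulrCA; rewrite mulrA -mulrA.
    by rewrite [sg i J * _]mulrC; have := sg_sq i J; move=> e; ring: e.
  move=> j /andP[hj hji]; rewrite ffunE in_setU1 (negbTE hi) orbF eq_sym (negbTE hji).
  by rewrite mulr0.
set J0 := J :\ i; have hJ : J = i |: J0 by rewrite setD1K.
have hi0 : i \notin J0 by rewrite !inE eqxx.
rewrite ffunE [in X in _ + X](bigD1 i) //= -hJ mulrDr addrCA.
have e2 := sg_sq i J0.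
rewrite (_ : sg i J0 * (sg i J0 * f i * v J) = f i * v J); last by ring: e2.
rewrite mulr_sumr -[RHS]addr0; congr (_ + _).
have -> : \sum_(j | (j \notin J0) && (j != i)) sg i J0 * (sg j J0 * f j * v (j |: J0)) =
    \sum_(j | j \notin J) sg i J0 * (sg j J0 * f j * v (j |: J0)).
  by apply: eq_bigl => j; rewrite hJ in_setU1 negb_or andbC.
rewrite -big_split big1 //= => j hj.
have hji : j != i by apply: contraNneq hj => ->.
have hj0 : j \notin J0 by apply: contra hj; rewrite !inE => /andP[].
rewrite ffunE in_setU1 hi orbT.
have -> : (j |: J) :\ i = j |: J0.
  by rewrite hJ setUCA setU1K // in_setU1 negb_or eq_sym hji hi0.
rewrite {1}hJ !sgU1 // (sg1_anti hji).
have e1 : sg i [set j] * sg i [set j] = 1 by exact: sg_sq.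
ring: e1.
Qed.

(** * Multiplication and comultiplication of the exterior algebra *)

Definition emul (w : fvec (S * S)%type) : fvec S :=
  [ffun H : S => \sum_(J : S | J \subset H) sgn J (H :\: J) * w (J, H :\: J)].

Lemma sum_subset_mem i H (F : S -> P) : i \notin H ->
  \sum_(J : S | (J \subset i |: H) && (i \in J)) F J = \sum_(J : S | J \subset H) F (i |: J).
Proof.
move=> hi; rewrite (reindex_onto (fun J => i |: J) (fun J => J :\ i)) /=; last first.
  by move=> J /andP[_ h]; rewrite setD1K.
apply: eq_bigl => J; rewrite setU11 andbT; apply/andP/idP => [[h /eqP e]|h].
  by rewrite -(setU1K hi) -e; apply: setSD.
rewrite setUS // setU1K //; apply: contra hi; exact: (subsetP h).
Qed.

Lemma sum_subsetU1 i H (F : S -> P) : i \notin H ->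
  \sum_(J : S | J \subset i |: H) F J =
  \sum_(J : S | J \subset H) F (i |: J) + \sum_(J : S | J \subset H) F J.
Proof.
move=> hi; rewrite (bigID (fun J : S => i \in J)) /= sum_subset_mem //; congr (_ + _).
by apply: eq_bigl => J; rewrite -subsetD1 setU1K.
Qed.

(** The graded Leibniz rule. Indices [i] outside [H] give the left side, according to whether [i]
    joins [J] or its complement; the contributions with [i] in [H] cancel. *)
Lemma kbd_emul u :
  kbd (emul u) = emul (tensl kbd u) + emul (ftwist (fun p : S * S => #|p.1|) (tensr kbd u)).
Proof.
apply/ffunP => H; rewrite fvE [LHS]ffunE [emul (tensl _ _) _]ffunE [emul (ftwist _ _) _]ffunE.
pose A J i := sgn J (H :\: J) * (sg i J * f i * u (i |: J, H :\: J)).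
pose B J i := sgn J (H :\: J) * ((-1) ^+ #|J| * (sg i (H :\: J) * f i * u (J, i |: (H :\: J)))).
have sgH i J : J \subset H -> sg i H = sg i J * sg i (H :\: J).
  move=> hJ; rewrite -sgU ?setDE ?setUIr ?setUCr ?setIT; first by rewrite (setUidPr hJ).
  by rewrite -setDE -setI_eq0 setIDA setIC setDIl setDv setI0.
have -> : \sum_(J : S | J \subset H) sgn J (H :\: J) * tensl kbd u (J, H :\: J) =
    \sum_(J : S | J \subset H) (\sum_(i | i \notin H) A J i + \sum_(i | i \in H :\: J) A J i).
  apply: eq_bigr => J hJ; rewrite !ffunE /= mulr_sumr (bigID (fun i => i \notin H)) /=.
  congr (_ + _); apply: eq_big => [i|i _]; rewrite /A ?ffunE //.
    by rewrite andb_idl // => h; apply: contra h; exact: (subsetP hJ).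
  by rewrite negbK inE.
have -> : \sum_(J : S | J \subset H)
      sgn J (H :\: J) * ftwist (fun p : S * S => #|p.1|) (tensr kbd u) (J, H :\: J) =
    \sum_(J : S | J \subset H) (\sum_(i | i \notin H) B J i + \sum_(i | i \in J) B J i).
  apply: eq_bigr => J hJ; rewrite !ffunE /= !mulr_sumr (bigID (fun i => i \notin H)) /=.
  congr (_ + _); apply: eq_big => [i|i _]; rewrite /B ?ffunE //.
    by rewrite andb_idl // => h; rewrite inE negb_and h orbT.
  rewrite negbK inE negb_and negbK; case: (boolP (i \in J)) => [/(subsetP hJ) ->|_] //=.
  by rewrite andNb.
rewrite !big_split /= addrACA -[LHS]addr0; congr (_ + _).
  rewrite exchange_big [X in _ = _ + X]exchange_big -big_split /=.
  apply: eq_bigr => i hi; rewrite ffunE sum_subsetU1 // -!big_split mulr_sumr /=.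
  apply: eq_bigr => J hJ.
  have hiJ : i \notin J by apply: contra hi; exact: (subsetP hJ).
  have hiH : i \notin H :\: J by rewrite inE negb_and hi orbT.
  have e1 : (i |: H) :\: (i |: J) = H :\: J.
    apply/setP => k; rewrite !inE; case: (k =P i) => [->|_] //=.
    by rewrite (negbTE hi) andbF.
  have e2 : (i |: H) :\: J = i |: (H :\: J).
    by apply/setP => k; rewrite !inE; case: (k =P i) => [->|_] //=; rewrite hiJ.
  rewrite e1 e2 sgnU1l // sgnU1r // (sgH i J hJ) /A /B.
  have s1 := sg_sq i J; have s2 := sg_sq i (H :\: J).
  ring: s1 s2.
(* [A J i] cancels [B (i |: J) i]: both contain [f i * u (i |: J, H :\: J)], with opposite signs. *)
apply/esym; rewrite (exchange_big_dep (mem H)) /=; last by move=> J i _; rewrite inE => /andP[].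
rewrite [X in _ + X](exchange_big_dep (mem H)) /=; last by move=> J i /subsetP h /h.
rewrite -big_split big1 //= => i hi.
set H0 := H :\ i; have hH : H = i |: H0 by rewrite setD1K.
have hi0 : i \notin H0 by rewrite !inE eqxx.
have -> : \sum_(J : S | (J \subset H) && (i \in J)) B J i = \sum_(J : S | J \subset H0) B (i |: J) i.
  by rewrite [in LHS]hH (sum_subset_mem (fun J => B J i)) //.
have -> : \sum_(J : S | (J \subset H) && (i \in H :\: J)) A J i = \sum_(J : S | J \subset H0) A J i.
  by apply: eq_bigl => J; rewrite subsetD1 inE hi andbT.
rewrite -big_split big1 //= => J hJ; clearbody H0.
have hiJ : i \notin J by apply: contra hi0; exact: (subsetP hJ).
set H' := H0 :\: J; have hiH' : i \notin H' by rewrite inE negb_and hi0 orbT.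
have e1 : H :\: J = i |: H'.
  rewrite hH /H'; apply/setP => k; rewrite !in_setU1 !in_setD !in_setU1.
  by case: (k =P i) => [->|_] //=; rewrite hiJ.
have e2 : H :\: (i |: J) = H'.
  rewrite hH /H'; apply/setP => k; rewrite !in_setD !in_setU1.
  by case: (k =P i) => [->|_] //=; rewrite (negbTE hi0) andbF.
rewrite /A /B e1 e2 sgnU1l // sgnU1r // cardsU1 hiJ add1n exprS.
have s1 := sg_sq i J; have s2 := sg_sq i H'.
ring: s1 s2.
Qed.

Lemma disjoint_setU1 i J J' : [disjoint i |: J & J'] = (i \notin J') && [disjoint J & J'].
Proof. by rewrite -!setI_eq0 setIUl setU_eq0 !setI_eq0 disjoints1. Qed.

Definition ecomul (s t : nat) (v : fvec S) : fvec (S * S)%type :=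
  [ffun p : S * S => if [&& [disjoint p.1 & p.2], #|p.1| == s & #|p.2| == t]
                     then sgn p.1 p.2 * v (p.1 :|: p.2) else 0].

Lemma ecomul_is_linear s t : linear (ecomul s t).
Proof. by move=> a u v; apply/ffunP => p; rewrite !(ffunE, fvE); case: ifP => _; ring. Qed.
HB.instance Definition _ s t :=
  GRing.isLinear.Build P (fvec S) (fvec (S * S)%type) _ (ecomul s t) (ecomul_is_linear s t).

Lemma emul_is_linear : linear emul.
Proof.
move=> a u v; apply/ffunP => H; rewrite fvE fvE !ffunE mulr_sumr -big_split /=.
by apply: eq_bigr => J _; rewrite !(ffunE, fvE); ring.
Qed.
HB.instance Definition _ :=
  GRing.isLinear.Build P (fvec (S * S)%type) (fvec S) _ emul emul_is_linear.

(** Up to sign, contracting the first factor of the [(s, t)] component is the [(s - 1, t)] component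
    of the comultiplication of [kbd v]; the condition [b] encodes that component. *)
Lemma tensl_ecomul s t v : kbd v = 0 -> tensl kbd (ecomul s t v) = 0.
Proof.
move=> hv; apply/ffunP => -[J J']; rewrite fvE !ffunE /=.
set b := [&& [disjoint J & J'], (#|J|).+1 == s & #|J'| == t].
transitivity (if b then sgn J J' * kbd v (J :|: J') else 0); last first.
  by rewrite hv fvE mulr0 if_same.
rewrite [kbd v _]ffunE mulr_sumr.
transitivity (\sum_(i | i \notin J :|: J')
    if b then sgn J J' * (sg i (J :|: J') * f i * v (i |: (J :|: J'))) else 0); last first.
  by case: b => //; rewrite big1.
rewrite big_mkcond [RHS]big_mkcond; apply: eq_bigr => i _.
rewrite in_setU negb_or; case: (boolP (i \in J)) => //= hi.
rewrite ffunE ffunE /= disjoint_setU1 cardsU1 hi add1n /b.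
case: (boolP (i \in J')) => //= hi'; first by rewrite mulr0.
case: ifP => [/andP[hd _]|_]; last by rewrite mulr0.
by rewrite sgnU1l // sgU // setUA; ring.
Qed.

Lemma tensr_ecomul s t v : kbd v = 0 -> tensr kbd (ecomul s t v) = 0.
Proof.
move=> hv; apply/ffunP => -[J J']; rewrite fvE !ffunE /=.
set b := [&& [disjoint J & J'], #|J| == s & (#|J'|).+1 == t].
transitivity (if b then (-1) ^+ #|J| * sgn J J' * kbd v (J :|: J') else 0); last first.
  by rewrite hv fvE mulr0 if_same.
rewrite [kbd v _]ffunE mulr_sumr.
transitivity (\sum_(i | i \notin J :|: J') if b
    then (-1) ^+ #|J| * sgn J J' * (sg i (J :|: J') * f i * v (i |: (J :|: J'))) else 0); last first.
  by case: b => //; rewrite big1.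
rewrite big_mkcond [RHS]big_mkcond; apply: eq_bigr => i _.
rewrite in_setU negb_or andbC; case: (boolP (i \in J')) => //= hi'.
rewrite ffunE ffunE /= disjoint_sym disjoint_setU1 disjoint_sym cardsU1 hi' add1n /b.
case: (boolP (i \in J)) => //= hi; first by rewrite mulr0.
case: ifP => [/andP[hd _]|_]; last by rewrite mulr0.
by rewrite sgnU1r // sgU // setUCA; ring.
Qed.

(** Every subset [J] of [H] with [s] elements contributes a squared sign, so the scalar counts these
    subsets. *)
Lemma emul_ecomul s t v : supp [pred H : S | #|H| == s + t]%N v ->
  emul (ecomul s t v) = 'C(s + t, s)%:R *: v.
Proof.
move=> hv; apply/ffunP => H; rewrite fvE ffunE.
transitivity (\sum_(J : S | J \subset H) if #|J| == s then v H else 0).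
  apply: eq_bigr => J hJ; rewrite ffunE /= disjoints_subset setCD subsetUr /=.
  have eU : J :|: H :\: J = H by rewrite setDE setUIr setUCr setIT (setUidPr hJ).
  have cH : #|H| = (#|J| + #|H :\: J|)%N by rewrite -(cardsID J H) (setIidPr hJ).
  rewrite eU; case: eqP => hs /=; last by rewrite mulr0.
  case: eqP => ht; first by rewrite mulrA sgn_sq mul1r.
  by rewrite mulr0 hv //= cH hs eqn_add2l; apply/eqP.
have [/eqP hH|hH] := boolP (#|H| == s + t)%N; last first.
  by rewrite hv // mulr0 big1 // => J _; rewrite if_same.
rewrite -big_mkcondr /= sumr_const -hH mulr_natl; congr (_ *+ _).
by rewrite -cards_draws; apply: eq_card => J; rewrite !inE.
Qed.

Definition sdeg (df : 'I_m -> nat) (J : S) : nat := (\sum_(i in J) df i)%N.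

Section Graded.
Variable df : 'I_m -> nat.
Hypothesis hf : forall i, f i \is (df i).-homog.
Local Notation sdeg := (sdeg df).

Lemma sg_tr e i J p : tr e (sg i J * p) = sg i J * tr e p.
Proof. by rewrite /sg -signr_odd; case: odd; rewrite ?expr1 ?expr0 ?mul1r // !mulN1r raddfN. Qed.

Lemma sgn_tr e J J' p : tr e (sgn J J' * p) = sgn J J' * tr e p.
Proof.
rewrite /sgn; elim/big_rec: _ p => [|i x _ IH] p; first by rewrite !mul1r.
by rewrite -!mulrA sg_tr IH.
Qed.

Lemma kbd_graded : graded_map sdeg sdeg kbd.
Proof.
move=> e u; apply/ffunP => J; rewrite !ffunE raddf_sum; apply: eq_bigr => i hi /=.
rewrite ffunE -!mulrA sg_tr; congr (_ * _); rewrite mulrC [f i * _]mulrC.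
rewrite -(tr_mul_homog _ _ (hf i)); congr tr.
by rewrite /sdeg big_setU1 //= PoszD; lia.
Qed.

Lemma ecomul_graded s t : graded_map sdeg (tdeg sdeg sdeg) (ecomul s t).
Proof.
move=> e u; apply/ffunP => -[J J']; rewrite !ffunE /=; case: ifP; last by rewrite raddf0.
move=> /andP[hd _]; rewrite sgn_tr; congr (_ * tr _ _); rewrite /tdeg /sdeg /=.
by rewrite -bigU //=; congr (_ - Posz _); apply: eq_bigl => i; rewrite !inE.
Qed.

End Graded.

Lemma kbd_supp t v : supp [pred J : S | #|J| == t.+1] v -> supp [pred J : S | #|J| == t] (kbd v).
Proof.
move=> hv J /= hJ; rewrite ffunE big1 // => i hi; rewrite hv ?mulr0 //=.
by rewrite cardsU1 hi.
Qed.

Lemma wedge_supp t i v : supp [pred J : S | #|J| == t] v ->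
  supp [pred J : S | #|J| == t.+1] (wedge i v).
Proof.
move=> hv J /= hJ; rewrite ffunE; case: ifP => // hi; rewrite hv ?mulr0 //=.
by apply: contra hJ => /eqP <-; rewrite (cardsD1 i J) hi.
Qed.

Lemma emul_supp s t w : supp [pred p : S * S | (#|p.1| == s) && (#|p.2| == t)] w ->
  supp [pred H : S | #|H| == s + t]%N (emul w).
Proof.
move=> hw H /= hH; rewrite ffunE big1 // => J hJ; rewrite hw ?mulr0 //=.
apply: contra hH => /andP[/eqP <- /eqP <-].
by rewrite -(cardsID J H) (setIidPr hJ).
Qed.

Lemma ecomul_supp s t v :
  supp [pred p : S * S | (#|p.1| == s) && (#|p.2| == t)] (ecomul s t v).
Proof. by move=> [J J'] /= hJ; rewrite ffunE /= (negbTE hJ) andbF. Qed.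

End Exterior.

(** * The tensor product of two resolutions of Koszul cycles *)

(* A graded free resolution of the module of [t]-cycles of the Koszul complex of
   [f], whose terms are gathered in a single free module; [fr_pos] records the
   homological position of the basis elements. *)
Record flat_resolution (K : fieldType) (n m : nat) (f : 'I_m -> {mpoly K[n]}) (df : 'I_m -> nat)
    (t : nat) (a : int) := FlatResolution {
  fr_basis : finType;
  fr_pos : fr_basis -> nat;
  fr_deg : fr_basis -> nat;
  fr_d : {linear fvec K n fr_basis -> fvec K n fr_basis};
  fr_eps : {linear fvec K n fr_basis -> fvec K n {set 'I_m}};
  fr_d_supp : forall k u, supp [pred x | fr_pos x == k.+1] u -> supp [pred x | fr_pos x == k] (fr_d u);
  fr_d_supp0 : forall u, supp [pred x | fr_pos x == 0%N] u -> fr_d u = 0;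
  fr_eps_supp : forall k u, supp [pred x | fr_pos x == k.+1] u -> fr_eps u = 0;
  fr_dd : forall u, fr_d (fr_d u) = 0;
  fr_eps_d : forall u, fr_eps (fr_d u) = 0;
  fr_d_twist : forall u, fr_d (ftwist fr_pos u) = - ftwist fr_pos (fr_d u);
  fr_eps_twist : forall u, fr_eps (ftwist fr_pos u) = fr_eps u;
  fr_exact0 : forall u, supp [pred x | fr_pos x == 0%N] u -> fr_eps u = 0 ->
    exists2 w, supp [pred x | fr_pos x == 1%N] w & fr_d w = u;
  fr_exact : forall k u, supp [pred x | fr_pos x == k.+1] u -> fr_d u = 0 ->
    exists2 w, supp [pred x | fr_pos x == k.+2] w & fr_d w = u;
  fr_eps_card : forall u, supp [pred J : {set 'I_m} | #|J| == t] (fr_eps u);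
  fr_eps_cycle : forall u, kbd f (fr_eps u) = 0;
  fr_surj : forall v, supp [pred J : {set 'I_m} | #|J| == t] v -> kbd f v = 0 ->
    exists2 u, supp [pred x | fr_pos x == 0%N] u & fr_eps u = v;
  fr_d_graded : graded_map fr_deg fr_deg fr_d;
  fr_eps_graded : graded_map fr_deg (sdeg df) fr_eps;
  fr_deg_le : forall x, (fr_deg x)%:Z <= a + (fr_pos x)%:Z }.

Section TensorComplex.
Variables (K : fieldType) (n m : nat).
Local Notation P := {mpoly K[n]}.
Local Notation fvec := (@fvec K n).
Local Notation S := {set 'I_m}.

Section Lifts.
Variables (B C C' : finType) (g : {linear fvec C -> fvec C'}).

Lemma lift_rows (Q : B -> fvec C -> Prop) (u : fvec (B * C')%type) :
  (forall b, exists2 w, Q b w & g w = frow b u) ->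
  exists2 w, (forall b, Q b (frow b w)) & tensr g w = u.
Proof.
move=> h; have [W hW] : exists W : B -> fvec C, forall b, Q b (W b) /\ g (W b) = frow b u.
  by apply: (fin_all_exists (P := fun b w => Q b w /\ g w = frow b u)) => b; case: (h b) => w; exists w.
have e b : frow b ([ffun p => W p.1 p.2] : fvec (B * C)%type) = W b.
  by apply/ffunP => c; rewrite !ffunE.
exists [ffun p => W p.1 p.2]; first by move=> b; rewrite e; case: (hW b).
by apply/ffunP => -[b c]; rewrite ffunE /= e; case: (hW b) => _ ->; rewrite ffunE.
Qed.

Lemma lift_cols (Q : B -> fvec C -> Prop) (u : fvec (C' * B)%type) :
  (forall b, exists2 w, Q b w & g w = fcol b u) ->
  exists2 w, (forall b, Q b (fcol b w)) & tensl g w = u.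
Proof.
move=> h; have [W hW] : exists W : B -> fvec C, forall b, Q b (W b) /\ g (W b) = fcol b u.
  by apply: (fin_all_exists (P := fun b w => Q b w /\ g w = fcol b u)) => b; case: (h b) => w; exists w.
have e b : fcol b ([ffun p => W p.2 p.1] : fvec (C * B)%type) = W b.
  by apply/ffunP => c; rewrite !ffunE.
exists [ffun p => W p.2 p.1]; first by move=> b; rewrite e; case: (hW b).
by apply/ffunP => -[c b]; rewrite ffunE /= e; case: (hW b) => _ ->; rewrite ffunE.
Qed.

End Lifts.

Variables (f : 'I_m -> P) (df : 'I_m -> nat) (s t : nat) (a b : int).
Variables (F : flat_resolution f df s a) (G : flat_resolution f df t b).
Local Notation BF := (fr_basis F).
Local Notation BG := (fr_basis G).
Local Notation BB := (BF * BG)%type.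
Local Notation dF := (fr_d F).
Local Notation dG := (fr_d G).
Local Notation eF := (fr_eps F).
Local Notation eG := (fr_eps G).
Local Notation "'posF' x" := (@fr_pos K n m f df s a F x) (at level 10).
Local Notation "'posG' x" := (@fr_pos K n m f df t b G x) (at level 10).

Definition tpos (p : BB) : nat := (posF p.1 + posG p.2)%N.
Local Notation tsupp j := (supp [pred p | tpos p == j]).

Definition tdiff (u : fvec BB) : fvec BB :=
  tensl dF u + tensl (ftwist (@fr_pos _ _ _ _ _ _ _ F)) (tensr dG u).

Lemma tdiff_is_linear : linear tdiff.
Proof. by move=> x u v; rewrite /tdiff !linearP /= scalerDr addrACA. Qed.
HB.instance Definition _ := GRing.isLinear.Build P (fvec BB) (fvec BB) _ tdiff tdiff_is_linear.

Lemma tensl_twist (u : fvec BB) p :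
  tensl (ftwist (@fr_pos _ _ _ _ _ _ _ F)) u p = (-1) ^+ posF p.1 * u p.
Proof. by rewrite !ffunE -surjective_pairing. Qed.

Lemma fcol_tsupp j (u : fvec BB) c : tsupp j u ->
  supp [pred x | posF x == j - posG c]%N (fcol c u) /\ ((j < posG c)%N -> fcol c u = 0).
Proof.
move=> hu; split=> [x /= hx|h]; last apply/ffunP => x; rewrite ffunE ?fvE hu // /tpos /=; lia.
Qed.

Lemma frow_tsupp j (u : fvec BB) x : tsupp j u ->
  supp [pred c | posG c == j - posF x]%N (frow x u) /\ ((j < posF x)%N -> frow x u = 0).
Proof.
move=> hu; split=> [c /= hx|h]; last apply/ffunP => c; rewrite ffunE ?fvE hu // /tpos /=; lia.
Qed.

Lemma tdiff_supp j u : tsupp j.+1 u -> tsupp j (tdiff u).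
Proof.
move=> hu [x c]; rewrite /= /tpos /= => hp; rewrite fvE tensl_twist /= !ffunE /=.
have [h1 h1'] := fcol_tsupp c hu; have [h2 h2'] := frow_tsupp x hu.
have -> : dF (fcol c u) x = 0.
  case: (ltngtP j.+1 (posG c)) => h; first by rewrite h1' // fmap0 fvE.
    rewrite subSn // in h1; rewrite (fr_d_supp h1) //=; lia.
  by rewrite h subnn in h1; rewrite (fr_d_supp0 h1) fvE.
have -> : dG (frow x u) c = 0; last by rewrite mulr0 addr0.
case: (ltngtP j.+1 (posF x)) => h; first by rewrite h2' // fmap0 fvE.
  rewrite subSn // in h2; rewrite (fr_d_supp h2) //=; lia.
by rewrite h subnn in h2; rewrite (fr_d_supp0 h2) fvE.
Qed.

Lemma tdiff_supp0 u : tsupp 0 u -> tdiff u = 0.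
Proof.
move=> hu; apply/ffunP => -[x c]; rewrite !fvE tensl_twist /= !ffunE /=.
have [h1 _] := fcol_tsupp c hu; have [h2 _] := frow_tsupp x hu.
by rewrite sub0n in h1 h2; rewrite (fr_d_supp0 h1) (fr_d_supp0 h2) !fvE mulr0 add0r.
Qed.

Lemma tdiff_tdiff u : tdiff (tdiff u) = 0.
Proof.
rewrite {1}/tdiff /tdiff !raddfD /= !tensl_comp -!tensC !tensl_comp.
rewrite (_ : tensl (dF \o dF) u = 0); last first.
  by apply/ffunP => p; rewrite ffunE /= fr_dd !fvE.
rewrite (_ : tensr dG (tensr dG u) = 0); last first.
  by apply/ffunP => p; rewrite ffunE frow_tensr fr_dd !fvE.
rewrite raddf0 addr0 add0r; apply/ffunP => p; rewrite !fvE ffunE [in X in _ + X]ffunE /=.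
by rewrite fr_d_twist fvE addNr.
Qed.

Lemma tensl_eps_tdiff u : tensl eF (tdiff u) = tensr dG (tensl eF u).
Proof.
rewrite raddfD /= !tensl_comp -tensC (_ : tensl (eF \o dF) u = 0) ?add0r; last first.
  by apply/ffunP => p; rewrite ffunE /= fr_eps_d !fvE.
by apply/ffunP => p; rewrite ffunE [RHS]ffunE /= fr_eps_twist.
Qed.

Lemma tdiff_graded : graded_map (tdeg (@fr_deg _ _ _ _ _ _ _ F) (@fr_deg _ _ _ _ _ _ _ G))
  (tdeg (@fr_deg _ _ _ _ _ _ _ F) (@fr_deg _ _ _ _ _ _ _ G)) tdiff.
Proof.
move=> e u; rewrite /tdiff raddfD /=; congr (_ + _).
  by apply: tensl_graded; apply: fr_d_graded.
rewrite (tensr_graded _ (@fr_d_graded _ _ _ _ _ _ _ G)).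
by apply: tensl_graded; apply: ftwist_graded.
Qed.

(** [tensl eF] behaves as a quasi-isomorphism to the tensor product of the [s]-cycles with [G]: its
    columns are resolutions tensored with free modules. The components of [v] are removed in
    increasing [F]-position until the largest one is passed. *)
Lemma column_exact j (v : fvec BB) : tsupp j v -> tdiff v = 0 -> tensl eF v = 0 ->
  exists2 y, tsupp j.+1 y & tdiff y = v.
Proof.
pose M := \max_(x : BF) posF x.
suff main (d p : nat) (w : fvec BB) : (M < p + d)%N -> (forall x c, (posF x < p)%N -> w (x, c) = 0) ->
    tsupp j w -> tdiff w = 0 -> tensl eF w = 0 -> exists2 y, tsupp j.+1 y & tdiff y = w.
  by move=> h1 h2 h3; apply: (main M.+1 0%N) => //; rewrite add0n.
elim: d p w => [|d IH] p w hM hp hs hd he.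
  exists 0; first exact: supp0.
  rewrite raddf0; apply/ffunP => -[x c]; rewrite fvE hp //.
  by rewrite addn0 in hM; apply: leq_ltn_trans hM; apply: leq_bigmax.
(* The component in the lowest occupied [F]-position [p] is a cycle for [dF], as nothing of [w] in
   position [p - 1] can compensate for it. *)
pose wp := tensl (fproj [pred x | posF x == p]) w.
have wpE x c : wp (x, c) = if posF x == p then w (x, c) else 0 by rewrite !ffunE.
pose Q (c : BG) (y : fvec BF) := supp [pred x | posF x == p.+1] y /\ ((posG c + p)%N != j -> y = 0).
have [|y hy ey] := @lift_cols _ _ _ dF Q wp.
  move=> c; have [hc|hc] := eqVneq (posG c + p)%N j; last first.
    exists 0; first by split => //; apply: supp0.
    rewrite raddf0; apply/ffunP => x; rewrite fvE ffunE wpE; case: eqP => // hx.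
    by rewrite hs //= /tpos /= hx addnC.
  have [h1 _] := fcol_tsupp c hs; rewrite -hc addKn in h1.
  have -> : fcol c wp = fcol c w.
    apply/ffunP => x; rewrite ffunE wpE ffunE; case: eqP => // /eqP hx.
    by rewrite -[RHS](ffunE (fun x => w (x, c))) h1.
  have [y hy ey] : exists2 y, supp [pred x | posF x == p.+1] y & dF y = fcol c w; last first.
    by exists y => //; split => //; rewrite hc eqxx.
  case: (p) h1 hp hc => [|p'] h1 hp' hc.
    by apply: fr_exact0 => //; rewrite -fcol_tensl he raddf0.
  apply: fr_exact => //; apply/ffunP => x; rewrite fvE.
  have [hx|hx] := eqVneq (posF x) p'; last by rewrite (fr_d_supp h1).
  have := congr1 (fun z : fvec BB => z (x, c)) hd; rewrite /= !fvE tensl_twist !ffunE /=.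
  have -> : frow x w = 0 by apply/ffunP => c'; rewrite !fvE ffunE hp' // hx.
  by rewrite raddf0 fvE mulr0 addr0.
have hys : tsupp j.+1 y.
  move=> [x c]; rewrite /= /tpos /= => hxc; have [h1 h2] := hy c.
  have -> : y (x, c) = fcol c y x by rewrite ffunE.
  have [hc|/h2 ->] := eqVneq (posG c + p)%N j; last by rewrite fvE.
  by rewrite h1 //=; apply: contra hxc => /eqP ->; rewrite -hc; lia.
have [|||||z hz ez] := IH p.+1 (w - tdiff y).
- by rewrite addSn -addnS.
- move=> x c; rewrite ltnS => hx; rewrite !fvE tensl_twist /= [tensr _ _ _]ffunE /=.
  have -> : frow x y = 0.
    apply/ffunP => c'; rewrite !fvE ffunE; have [h1 _] := hy c'.
    have -> : y (x, c') = fcol c' y x by rewrite ffunE.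
    by rewrite h1 //=; lia.
  rewrite raddf0 fvE mulr0 addr0 ey wpE; case: ltngtP hx => // [hx _|hx _]; last by rewrite subrr.
  by rewrite hp // subr0.
- by apply: suppB => //; apply: tdiff_supp.
- by rewrite raddfB /= hd tdiff_tdiff subrr.
- rewrite raddfB /= he tensl_eps_tdiff sub0r (_ : tensl eF y = 0) ?raddf0 ?oppr0 //.
  apply/ffunP => p'; rewrite ffunE; have [h1 _] := hy p'.2.
  by rewrite (fr_eps_supp h1) !fvE.
exists (y + z); first exact: suppD.
by rewrite raddfD /= ez addrC subrK.
Qed.

End TensorComplex.

(** * Koszul homology of the module of bicycles *)

Section Bicycles.
Variables (K : fieldType) (n m : nat).
Local Notation P := {mpoly K[n]}.
Local Notation fvec := (@fvec K n).
Local Notation S := {set 'I_m}.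
Variables (f : 'I_m -> P) (df : 'I_m -> nat) (s t : nat) (a b : int).
Hypothesis hf : forall i, f i \is (df i).-homog.
Variables (F : flat_resolution f df s a) (G : flat_resolution f df t b).
Local Notation BF := (fr_basis F).
Local Notation BG := (fr_basis G).
Local Notation BB := (BF * BG)%type.
Local Notation dF := (fr_d F).
Local Notation dG := (fr_d G).
Local Notation eF := (fr_eps F).
Local Notation eG := (fr_eps G).
Local Notation "'posF' x" := (@fr_pos K n m f df s a F x) (at level 10).
Local Notation "'posG' x" := (@fr_pos K n m f df t b G x) (at level 10).
Local Notation tsupp j := (supp [pred p | @tpos K n m f df s t a b F G p == j]).
Local Notation tdiff := (@tdiff K n m f df s t a b F G).
Local Notation bisupp := (supp [pred p : S * S | (#|p.1| == s) && (#|p.2| == t)]).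

(** Pairing the two differentials makes the bicycles the kernel of a single map, which can then end
    a complex. *)
Definition biboundary (u : fvec (S * S)%type) : fvec (S * S + S * S)%type :=
  [ffun x => match x with inl p => tensl (kbd f) u p | inr p => tensr (kbd f) u p end].

Lemma biboundary_is_linear : linear biboundary.
Proof.
by move=> x u v; apply/ffunP => -[p|p]; rewrite fvE fvE ![biboundary _ _]ffunE linearP !fvE.
Qed.
HB.instance Definition _ :=
  GRing.isLinear.Build P (fvec (S * S)%type) (fvec (S * S + S * S)%type) _ biboundary biboundary_is_linear.

Lemma biboundary_eq0 u : biboundary u = 0 <-> tensl (kbd f) u = 0 /\ tensr (kbd f) u = 0.
Proof.
split=> [/ffunP h|[h1 h2]].
  split; apply/ffunP => p; first by have := h (inl p); rewrite ffunE !fvE.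
  by have := h (inr p); rewrite ffunE !fvE.
by apply/ffunP => -[p|p]; rewrite ffunE ?h1 ?h2 !fvE.
Qed.

Definition taug (u : fvec BB) : fvec (S * S)%type := tensr eG (tensl eF u).

Lemma taug_is_linear : linear taug.
Proof. by move=> x u v; rewrite /taug !linearP. Qed.
HB.instance Definition _ :=
  GRing.isLinear.Build P (fvec BB) (fvec (S * S)%type) _ taug taug_is_linear.

(** The complex is [F (x) G] shifted by two positions and continued by [taug] and [biboundary]. Its
    homology in position 1 is therefore the cokernel of the map from [F (x) G] to the bicycles. *)
Definition cbasis (k : nat) : finType :=
  match k with 0%N => (S * S + S * S)%type | 1%N => (S * S)%type | _ => BB end.
Definition cdeg (k : nat) : cbasis k -> nat :=
  match k return cbasis k -> nat with
  | 0%N => fun x => match x with inl p | inr p => tdeg (sdeg df) (sdeg df) p end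
  | 1%N => tdeg (sdeg df) (sdeg df)
  | _ => tdeg (@fr_deg _ _ _ _ _ _ _ F) (@fr_deg _ _ _ _ _ _ _ G)
  end.
Definition csupp (k : nat) : pred (cbasis k) :=
  match k return pred (cbasis k) with
  | 0%N => predT
  | 1%N => [pred p : S * S | (#|p.1| == s) && (#|p.2| == t)]
  | j.+2 => [pred p : BB | tpos p == j]
  end.
Definition cdiff (k : nat) : {linear fvec (cbasis k.+1) -> fvec (cbasis k)} :=
  match k return {linear fvec (cbasis k.+1) -> fvec (cbasis k)} with
  | 0%N => (biboundary : {linear _ -> _})
  | 1%N => (taug : {linear _ -> _})
  | _ => (tdiff : {linear _ -> _})
  end.

Lemma bisupp_taug u : bisupp (taug u).
Proof.
move=> [J J'] /=; rewrite negb_and => /orP[h|h]; rewrite /taug.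
  by rewrite -tensC ffunE (@fr_eps_card _ _ _ _ _ _ _ F).
by rewrite ffunE (@fr_eps_card _ _ _ _ _ _ _ G).
Qed.

Lemma cdiff_supp k u : supp (@csupp k.+1) u -> supp (@csupp k) (cdiff k u).
Proof.
case: k u => [|[|k]] u hu; first by move=> x.
  exact: bisupp_taug.
exact: tdiff_supp.
Qed.

Lemma cdiff_cdiff k u : supp (@csupp k.+2) u -> cdiff k (cdiff k.+1 u) = 0.
Proof.
case: k u => [|[|k]] u _ /=; last exact: tdiff_tdiff.
  apply/biboundary_eq0; split; rewrite /taug; last first.
    by apply/ffunP => p; rewrite ffunE frow_tensr /= fr_eps_cycle !fvE.
  rewrite tensC tensl_comp (_ : tensl _ u = 0) ?raddf0 //.
  by apply/ffunP => p; rewrite ffunE /= fr_eps_cycle !fvE.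
rewrite /taug tensl_eps_tdiff.
by apply/ffunP => p; rewrite ffunE frow_tensr fr_eps_d !fvE.
Qed.

Lemma cdiff_graded k : graded_map (@cdeg k.+1) (@cdeg k) (cdiff k).
Proof.
case: k => [|[|k]] e u; last exact: tdiff_graded.
  have hl := tensl_graded (sdeg df) (kbd_graded hf); have hr := tensr_graded (sdeg df) (kbd_graded hf).
  by apply/ffunP => -[p|p]; rewrite [LHS]ffunE ?hl ?hr !ffunE.
by rewrite /= /taug (tensl_graded _ (@fr_eps_graded _ _ _ _ _ _ _ F))
  (tensr_graded _ (@fr_eps_graded _ _ _ _ _ _ _ G)).
Qed.

Lemma cdeg_le k (x : cbasis k.+2) : csupp x -> (cdeg x)%:Z <= a + b + k%:Z.
Proof.
case: x => x c /= /eqP <-; rewrite /tdeg /tpos /=.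
have := @fr_deg_le _ _ _ _ _ _ _ F x; have := @fr_deg_le _ _ _ _ _ _ _ G c; lia.
Qed.

(* Multiplication by [f i] on the [s]-cycles factors through the free module of
   [s+1]-chains, via [wedge i] and [kbd]. *)
Section Homotopy.
Variable i : 'I_m.
Let phi : {linear fvec S -> fvec S} := kbd f \o wedge i.

Let phi_cycle v : kbd f v = 0 -> kbd f (wedge i v) = f i *: v.
Proof. by move=> h; have := wedge_homotopy f i v; rewrite h raddf0 addr0. Qed.

Let lift_phi j (w : fvec (S * BG)%type) :
  (forall J, supp [pred c | posG c == j] (frow J w) /\ (#|J| != s -> frow J w = 0)) ->
  exists2 w' : fvec BB, tsupp j w' & tensl eF w' = tensl phi w.
Proof.
move=> hw; pose Q (c : BG) (y : fvec BF) :=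
  supp [pred x | posF x == 0%N] y /\ (posG c != j -> y = 0).
have [|y hy ey] := @lift_cols _ _ _ _ _ eF Q (tensl phi w).
  move=> c; rewrite fcol_tensl; have [hc|hc] := eqVneq (posG c) j; last first.
    exists 0; first by split => //; apply: supp0.
    rewrite raddf0 (_ : fcol c w = 0) ?raddf0 //; apply/ffunP => J; rewrite fvE ffunE.
    by have [h _] := hw J; have := h c hc; rewrite ffunE.
  have [||y hy ey] := fr_surj F (v := phi (fcol c w)).
  - apply: kbd_supp; apply: wedge_supp => J /= hJ; have [_ /(_ hJ)] := hw J.
    by move/ffunP/(_ c); rewrite !ffunE.
  - exact: kbd_kbd.
  by exists y => //; split => //; rewrite hc eqxx.
exists y => // -[x c] /=; rewrite /tpos /= => hx.
have -> : y (x, c) = fcol c y x by rewrite ffunE.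
have [h1 h2] := hy c; have [hc|/h2 ->] := eqVneq (posG c) j; last by rewrite fvE.
by apply: h1; apply: contra hx => /eqP /= ->; rewrite hc.
Qed.

(** Lifting along [G] is possible over the free module of [s]-chains but may leave the cycles.
    Applying [phi] brings the lift back into the cycles, where it lifts along [eF]; on cycles [phi]
    is multiplication by [f i], which is the price of the detour. *)
Lemma homology_annihilated k (v : fvec (cbasis k.+1)) : supp (@csupp k.+1) v -> cdiff k v = 0 ->
  exists2 w, supp (@csupp k.+2) w & f i *: v = cdiff k.+1 w.
Proof.
case: k v => [|j] v hv hd.
  have [hl hr] := (biboundary_eq0 v).1 hd.
  pose Q (J : S) (y : fvec BG) := supp [pred c | posG c == 0%N] y /\ (#|J| != s -> y = 0).
  have [|w hw ew] := @lift_rows _ _ _ _ _ eG Q v.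
    move=> J; have [hJ|hJ] := boolP (#|J| == s); last first.
      exists 0; first by split => //; apply: supp0.
      by rewrite raddf0; apply/ffunP => J'; rewrite fvE ffunE hv //= (negbTE hJ).
    have [||y hy ey] := fr_surj G (v := frow J v).
    - by move=> J' /= hJ'; rewrite ffunE hv //= negb_and hJ' orbT.
    - by rewrite -frow_tensr hr raddf0.
    by exists y => //; split => //; rewrite hJ.
  have [w' hw' ew'] := lift_phi hw; exists w' => //.
  rewrite /= /taug ew' -tensC ew; apply/ffunP => -[J J']; rewrite fvE [RHS]ffunE /phi /= phi_cycle.
    by rewrite fvE ffunE.
  by rewrite -fcol_tensl hl raddf0.
pose v0 := tensl eF v.
have hv0 : tensl (kbd f) v0 = 0.
  by rewrite /v0 tensl_comp; apply/ffunP => p; rewrite ffunE /= fr_eps_cycle !fvE.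
have hrow J : supp [pred c | posG c == j] (frow J v0).
  move=> c /= hc; rewrite !ffunE /=; have [h1 h2] := fcol_tsupp c hv.
  case: (ltngtP j (posG c)) hc => // h _; first by rewrite h2 // raddf0 fvE.
  rewrite (_ : j - posG c = (j - posG c).-1.+1)%N in h1; last by lia.
  by rewrite (fr_eps_supp h1) fvE.
have hrow0 (J : S) : #|J| != s -> frow J v0 = 0.
  by move=> hJ; apply/ffunP => c; rewrite !ffunE /= (@fr_eps_card _ _ _ _ _ _ _ F).
have hex J : exists2 y : fvec BG, supp [pred c | posG c == j.+1] y & dG y = frow J v0.
  case: j v hv hd @v0 hv0 hrow hrow0 => [|j] v hv hd v0 hv0 hrow hrow0.
    by apply: fr_exact0 => //; rewrite -frow_tensr; move: hd; rewrite /= /taug -/v0 => ->; rewrite raddf0.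
  apply: fr_exact => //; rewrite -frow_tensr /v0 -tensl_eps_tdiff.
  by move: hd => /= ->; rewrite !raddf0.
pose Q (J : S) (y : fvec BG) := supp [pred c | posG c == j.+1] y /\ (#|J| != s -> y = 0).
have [|w hw ew] := @lift_rows _ _ _ _ _ dG Q v0.
  move=> J; have [hJ|hJ] := boolP (#|J| == s); last first.
    exists 0; first by split => //; apply: supp0.
    by rewrite raddf0 hrow0.
  by have [y hy ey] := hex J; exists y => //; split => //; rewrite hJ.
have [w' hw' ew'] := lift_phi hw.
(* After this correction the cycle is killed by the augmentation of [F], so [column_exact]
   applies. *)
have hv' : tensl eF (f i *: v - tdiff w') = 0.
  rewrite raddfB /= tensl_eps_tdiff ew' -tensC ew linearZ /= -/v0.
  apply/eqP; rewrite subr_eq0; apply/eqP/ffunP => -[J c]; rewrite fvE [RHS]ffunE /phi /= phi_cycle.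
    by rewrite fvE [fcol _ _ _]ffunE.
  by rewrite -fcol_tensl hv0 raddf0.
have hs' : tsupp j (f i *: v - tdiff w').
  by apply: suppB; [exact: suppZ hv | exact: tdiff_supp hw'].
have hd' : tdiff (f i *: v - tdiff w') = 0.
  rewrite raddfB /= tdiff_tdiff subr0 linearZ /=.
  case: j v hv hd {v0 hv0 hrow hrow0 hex Q w hw ew w' hw' ew' hv' hs'} => [|j] v hv hd.
    by rewrite tdiff_supp0 // scaler0.
  by move: hd => /= ->; rewrite scaler0.
have [y hy ey] := column_exact hs' hd' hv'.
exists (w' + y); first exact: suppD hw' hy.
by rewrite raddfD /= ey addrC subrK.
Qed.

End Homotopy.

Theorem kvan_bicycles i : (0 < n)%N ->
  (forall j : 'I_n, exists q, in_gen_ideal f predT ('X_j ^+ q)) ->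
  kvan (tdeg (sdeg df) (sdeg df)) (fun u => bisupp u /\ biboundary u = 0) i (a + b).
Proof.
move=> hn hI.
have hvan : forall k (v : fvec (cbasis k.+1)), supp (@csupp k.+1) v ->
    above (@cdeg k.+1) (a + b + k%:Z - 1) v -> cdiff k v = 0 ->
    exists2 w, supp (@csupp k.+2) w & cdiff k.+1 w = v.
  apply: (homology_vanish cdiff_supp cdiff_cdiff cdiff_graded _ hn cdeg_le).
  (* The maximum gives one exponent for all variables; the power is a combination of the [f i], each
     of which kills the homology. *)
  have [q hq] := fin_all_exists hI; exists (\max_j q j)%N => k v j hj hv hd.
  have [W hW] : exists W, forall i : 'I_m, supp (@csupp k.+2) (W i) /\ f i *: v = cdiff k.+1 (W i).
    apply: (fin_all_exists (P := fun i w => supp (@csupp k.+2) w /\ f i *: v = cdiff k.+1 w)) => i0.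
    by have [w hw ew] := homology_annihilated i0 hv hd; exists w.
  have [c ec] := hq (Ordinal hj).
  pose x := xpow K n (\max_j q j - q (Ordinal hj)) j.
  have ex : xpow K n (\max_j q j) j = \sum_i0 (x * c i0) * f i0.
    rewrite -(subnK (leq_bigmax (F := q) (Ordinal hj))) xpowD -/x.
    rewrite (xpow_ord _ _ (Ordinal hj)) ec mulr_sumr; apply: eq_bigr => i0 _; exact: mulrA.
  exists (\sum_i0 (x * c i0) *: W i0).
    by move=> p hp; rewrite fv_sumE big1 // => i0 _; rewrite fvE (hW i0).1 ?mulr0.
  rewrite ex scaler_suml raddf_sum; apply: eq_bigr => i0 _.
  by rewrite [RHS]fmapZ -(hW i0).2 scalerA.
(* The cycles in position 1 are the bicycles, hence [k = 0]. *)
have := kvan_cycles cdiff_supp cdiff_cdiff cdiff_graded cdeg_le hvan (i := i) (k := 0%N).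
by rewrite addr0.
Qed.

End Bicycles.

(** * From [Zcyc] and [reg_le] to flat resolutions *)

Section KoszulCycles.
Variables (K : fieldType) (n m : nat).
Local Notation P := {mpoly K[n]}.
Local Notation fvec := (@fvec K n).
Local Notation S := {set 'I_m}.
Local Notation kbasis := (@kbasis m).
Variables (f : 'I_m -> P) (df : 'I_m -> nat) (t : nat).

Definition kemb (v : fvec (kbasis t)) : fvec S :=
  [ffun J : S => if (insub J : option (kbasis t)) is Some x then v x else (0 : P)].
Definition kres (v : fvec S) : fvec (kbasis t) := [ffun x => v (val x)].

Lemma kemb_is_linear : linear kemb.
Proof.
move=> a u v; apply/ffunP => J; rewrite !fvE !ffunE; case: insub => [x|]; first by rewrite !fvE.
by rewrite mulr0 addr0.
Qed.
HB.instance Definition _ := GRing.isLinear.Build P (fvec (kbasis t)) (fvec S) _ kemb kemb_is_linear.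

Lemma kres_is_linear : linear kres.
Proof. by move=> a u v; apply/ffunP => J; rewrite !(ffunE, fvE). Qed.
HB.instance Definition _ := GRing.isLinear.Build P (fvec S) (fvec (kbasis t)) _ kres kres_is_linear.

Lemma kemb_val v (x : kbasis t) : kemb v (val x) = v x.
Proof. by rewrite ffunE valK. Qed.

Lemma kemb_supp v : supp [pred J : S | #|J| == t] (kemb v).
Proof. by move=> J /= hJ; rewrite ffunE insubF //; apply: negbTE. Qed.

Lemma kemb_kres v : supp [pred J : S | #|J| == t] v -> kemb (kres v) = v.
Proof.
move=> hv; apply/ffunP => J; rewrite ffunE; case: insubP => [x _ <-|h]; first by rewrite ffunE.
by rewrite hv.
Qed.

Lemma kres_kemb v : kres (kemb v) = v.
Proof. by apply/ffunP => x; rewrite ffunE kemb_val. Qed.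

Lemma kemb_graded : graded_map (kdeg df (t := t)) (sdeg df) kemb.
Proof.
move=> e u; apply/ffunP => J; rewrite !ffunE; case: insubP => [x _ <-|_]; last by rewrite raddf0.
by rewrite ffunE.
Qed.

Lemma kdiff_sum (v : fvec (kbasis t)) (J' : S) :
  \sum_(J : kbasis t) v J * kdiff f (val J) J' = kbd f (kemb v) J'.
Proof.
transitivity (\sum_(J : S) kemb v J * kdiff f J J').
  rewrite [RHS](bigID (fun J : S => #|J| == t)) /= [X in _ + X]big1 ?addr0; last first.
    by move=> J hJ; rewrite kemb_supp // mul0r.
  rewrite (reindex_omap (fun x : kbasis t => val x) insub) /=; last first.
    by move=> J hJ; rewrite insubT.
  apply: eq_big => [x|x _]; last by rewrite kemb_val.
  by rewrite valK eqxx andbT; apply/esym; exact: valP x.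
rewrite ffunE; under eq_bigr do rewrite /kdiff mulr_sumr.
rewrite (exchange_big_dep predT) //= [RHS]big_mkcond; apply: eq_bigr => i _.
case: ifPn => hi; last first.
  by rewrite big1 // => J /andP[_ /eqP e]; rewrite e !inE eqxx in hi.
rewrite (big_pred1 (i |: J')) => [|J /=]; last first.
  apply/andP/eqP => [[hJ /eqP ->]|->]; first by rewrite setD1K.
  by rewrite setU11 setU1K.
rewrite -[(-1) ^+ _]/(sg K n i (i |: J')) sgU1 // sg1 ltnn mul1r.
by rewrite mulrC.
Qed.

Lemma ZcycE (v : kbasis t -> P) : Zcyc f v <-> kbd f (kemb (finfun v)) = 0.
Proof.
have e J' : \sum_(J : kbasis t) v J * kdiff f (val J) J' = kbd f (kemb (finfun v)) J'.
  by rewrite -kdiff_sum; apply: eq_bigr => J _; rewrite ffunE.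
split=> [h|h J']; last by rewrite e h fvE.
by apply/ffunP => J'; rewrite -e h fvE.
Qed.

Section Flatten.
Variable a : int.

Lemma lin_app_graded (I J : finType) (da : I -> nat) (db : J -> nat) (A : I -> J -> P) e u j :
  homog_map da db A ->
  lin_app A (fun i => tr (e - (da i)%:Z) (u i)) j = tr (e - (db j)%:Z) (lin_app A u j).
Proof.
move=> hA; rewrite /lin_app raddf_sum; apply: eq_bigr => i _ /=.
have [->|[h1 h2]] := hA i j; first by rewrite !mulr0 raddf0.
by rewrite -(tr_mul_homog _ _ h2); congr tr; lia.
Qed.

Lemma eq_lin_app (I J : finType) (A : I -> J -> P) u v j : u =1 v -> lin_app A u j = lin_app A v j.
Proof. by move=> h; apply: eq_bigr => i _; rewrite h. Qed.

Lemma lin_app0 (I J : finType) (A : I -> J -> P) u j : (forall i, u i = 0) -> lin_app A u j = 0.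
Proof. by move=> h; apply: big1 => i _; rewrite h mul0r. Qed.

Lemma lin_appP (I J : finType) (A : I -> J -> P) x u v j :
  lin_app A (fun i => x * u i + v i) j = x * lin_app A u j + lin_app A v j.
Proof.
rewrite /lin_app mulr_sumr -big_split; apply: eq_bigr => i _.
by rewrite /= mulrDl mulrA.
Qed.

Lemma lin_appZ (I J : finType) (A : I -> J -> P) x u j :
  lin_app A (fun i => x * u i) j = x * lin_app A u j.
Proof. by rewrite /lin_app mulr_sumr; apply: eq_bigr => i _; rewrite mulrA. Qed.

Variables (r : nat -> nat) (dg : forall i, 'I_(r i) -> nat).
Variables (d0 : 'I_(r 0) -> kbasis t -> P) (d : forall i, 'I_(r i.+1) -> 'I_(r i) -> P).
Variable N : nat.
Hypothesis hN : forall i, (N < i)%N -> r i = 0%N.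

Let B : finType := {i : 'I_N.+1 & 'I_(r i)}.

(** The default 0 beyond [N] is harmless because ['I_(r i)] is empty there. It makes components
    available for every natural number, so that differentials need no cast between positions. *)
Let comp (u : fvec B) (i : nat) (p : 'I_(r i)) : P :=
  match Sumbool.sumbool_of_bool (i < N.+1)%N with
  | left H => u (@Tagged _ (Ordinal H) (fun i : 'I_N.+1 => 'I_(r i)) p)
  | right _ => 0
  end.

Let compE u (x : B) : comp u (tagged x) = u x.
Proof.
case: x => [[i Hi] p]; rewrite /comp /=; case: Sumbool.sumbool_of_bool => H.
  by rewrite (bool_irrelevance H Hi).
by rewrite Hi in H.
Qed.

Let no_comp i (p : 'I_(r i)) : ~~ (i < N.+1)%N -> False.
Proof. by rewrite -leqNgt => /hN h; case: p => p; rewrite h. Qed.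

Let compP i (p : 'I_(r i)) : exists x : B,
  nat_of_ord (tag x) = i /\ (forall u, comp u p = u x) /\ dg (tagged x) = dg p.
Proof.
have [H|/(no_comp p) //] := boolP (i < N.+1)%N.
exists (@Tagged _ (Ordinal H) (fun i : 'I_N.+1 => 'I_(r i)) p); split => //; split => // u.
by rewrite -compE.
Qed.

Let comp_ext u v : (forall i (p : 'I_(r i)), comp u p = comp v p) -> u = v.
Proof. by move=> h; apply/ffunP => x; rewrite -!compE h. Qed.

Let supp_comp k u : supp [pred x : B | nat_of_ord (tag x) == k] u <->
  (forall i (p : 'I_(r i)), i != k -> comp u p = 0).
Proof.
split=> [h i p hi|h x hx]; last by rewrite -compE h.
by have [x [e1 [-> _]]] := compP p; apply: h; rewrite /= e1.
Qed.

Let single i (w : 'I_(r i) -> P) : fvec B :=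
  [ffun x : B => match nat_of_ord (tag x) =P i with
   | ReflectT e => w (cast_ord (congr1 r e) (tagged x)) | ReflectF _ => (0 : P) end].

Let comp_single i (w : 'I_(r i) -> P) p : comp (single w) p = w p.
Proof.
have [H|/(no_comp p) //] := boolP (i < N.+1)%N.
rewrite -[comp _ p]/(comp (single w) (tagged (@Tagged _ (Ordinal H) (fun i : 'I_N.+1 => 'I_(r i)) p))).
rewrite compE ffunE /=; case: eqP => // e.
by congr w; apply: val_inj.
Qed.

Let comp_single_ne i (w : 'I_(r i) -> P) i' (p : 'I_(r i')) : i' != i -> comp (single w) p = 0.
Proof.
have [x [e1 [-> _]]] := compP p; rewrite ffunE => h.
by case: eqP => // e; rewrite -e1 e eqxx in h.
Qed.

Let fd (u : fvec B) : fvec B := [ffun x : B => lin_app (@d (tag x)) (@comp u (tag x).+1) (tagged x)].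

Let comp_fd u i (p : 'I_(r i)) : comp (fd u) p = lin_app (@d i) (@comp u i.+1) p.
Proof.
have [H|/(no_comp p) //] := boolP (i < N.+1)%N.
rewrite -[comp _ p]/(comp (fd u) (tagged (@Tagged _ (Ordinal H) (fun i : 'I_N.+1 => 'I_(r i)) p))).
by rewrite compE ffunE.
Qed.

Let compPlin x u v i (p : 'I_(r i)) : comp (x *: u + v) p = x * comp u p + comp v p.
Proof. by have [y [_ [h _]]] := compP p; rewrite !h !fvE. Qed.

Let fd_is_linear : linear fd.
Proof.
move=> x u v; apply: comp_ext => i p; rewrite compPlin !comp_fd -lin_appP.
by apply: eq_lin_app => q; exact: compPlin.
Qed.
HB.instance Definition _ := GRing.isLinear.Build P (fvec B) (fvec B) _ fd fd_is_linear.

Let feps0 (u : fvec B) : fvec (kbasis t) := [ffun J => lin_app d0 (@comp u 0) J].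
Let feps0_is_linear : linear feps0.
Proof.
move=> x u v; apply/ffunP => J; rewrite !fvE !ffunE -lin_appP.
by apply: eq_lin_app => q; exact: compPlin.
Qed.
HB.instance Definition _ := GRing.isLinear.Build P (fvec B) (fvec (kbasis t)) _ feps0 feps0_is_linear.

Hypothesis hd0 : homog_map (@dg 0%N) (kdeg df (t := t)) d0.
Hypothesis hd : forall i, homog_map (@dg i.+1) (@dg i) (@d i).
Hypothesis hM : forall v, Zcyc f v <-> in_im d0 v.
Hypothesis hker0 : forall u, in_ker d0 u <-> in_im (@d 0%N) u.
Hypothesis hker : forall i u, in_ker (@d i) u <-> in_im (@d i.+1) u.
Hypothesis hdeg : forall i (p : 'I_(r i)), ((dg p)%:Z <= a + i%:Z).

Let comp0 i (p : 'I_(r i)) : comp 0 p = 0.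
Proof. by have [x [_ [-> _]]] := compP p; rewrite fvE. Qed.

Let comp_twist u i (p : 'I_(r i)) :
  comp (ftwist (fun x : B => nat_of_ord (tag x)) u) p = (-1) ^+ i * comp u p.
Proof. by have [x [e1 [h _]]] := compP p; rewrite !h ffunE e1. Qed.

Let comp_trunc e u i (p : 'I_(r i)) :
  comp (trunc (fun x : B => dg (tagged x)) e u) p = tr (e - (dg p)%:Z) (comp u p).
Proof. by have [x [e1 [h h2]]] := compP p; rewrite !h ffunE h2. Qed.

Lemma flatten_resolution : exists F : flat_resolution f df t a, True.
Proof.
pose eps : {linear fvec B -> fvec S} := kemb \o feps0.
have eps0 u : eps u = 0 -> in_ker d0 (@comp u 0).
  move=> h J; have := congr1 kres h; rewrite /eps /= kres_kemb raddf0 => /ffunP /(_ J).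
  by rewrite fvE ffunE.
unshelve eexists (@FlatResolution K n m f df t a B (fun x => tag x) (fun x => dg (tagged x))
  (fd : {linear _ -> _}) eps _ _ _ _ _ _ _ _ _ _ _ _ _ _ _) => //=.
- move=> k u /supp_comp hu; apply/supp_comp => i p hi; rewrite comp_fd.
  by apply: lin_app0 => q; apply: hu; rewrite eqSS.
- move=> u /supp_comp hu; apply: comp_ext => i p; rewrite comp_fd comp0.
  by apply: lin_app0 => q; apply: hu.
- move=> k u /supp_comp hu; rewrite (_ : feps0 u = 0) ?raddf0 //.
  apply/ffunP => J; rewrite ffunE fvE.
  by apply: lin_app0 => q; apply: hu.
- move=> u; apply: comp_ext => i p; rewrite comp_fd comp0.
  rewrite (eq_lin_app _ _ (fun q => comp_fd u q)).
  by move: p; apply/hker; exists (@comp u i.+2).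
- move=> u; rewrite (_ : feps0 _ = 0) ?raddf0 //; apply/ffunP => J; rewrite ffunE fvE.
  rewrite (eq_lin_app _ _ (fun q => comp_fd u q)).
  by move: J; apply/hker0; exists (@comp u 1).
- move=> u; apply: comp_ext => i p; rewrite -scaleN1r -[_ *: _]addr0 compPlin comp0 addr0.
  rewrite comp_twist !comp_fd mulrA -exprS -lin_appZ; apply: eq_lin_app => q.
  exact: comp_twist.
- move=> u; congr kemb; apply/ffunP => J; rewrite !ffunE; apply: eq_lin_app => q.
  by rewrite comp_twist expr0 mul1r.
- move=> u /supp_comp hu /eps0 /hker0 [w hw]; exists (single w).
    by apply/supp_comp => i p hi; apply: comp_single_ne.
  apply: comp_ext => -[|i] p; rewrite comp_fd.
    by rewrite hw; apply: eq_lin_app => q; rewrite comp_single.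
  by rewrite hu //; apply: lin_app0 => q; apply: comp_single_ne.
- move=> k u /supp_comp hu hdu; have /hker [w hw] : in_ker (@d k) (@comp u k.+1).
    by move=> p; rewrite -comp_fd hdu comp0.
  exists (single w); first by apply/supp_comp => i p hi; apply: comp_single_ne.
  apply: comp_ext => i p; rewrite comp_fd; have [e|hi] := eqVneq i k.+1.
    by move: p; rewrite e => p; rewrite hw; apply: eq_lin_app => q; rewrite comp_single.
  by rewrite hu //; apply: lin_app0 => q; apply: comp_single_ne.
- by move=> u; apply: kemb_supp.
- move=> u; have /hM/ZcycE : in_im d0 (lin_app d0 (@comp u 0)) by exists (@comp u 0).
  by move=> h; rewrite -[RHS]h; congr (kbd f (kemb _)).
- move=> v hv hv0; have /hM [w hw] : Zcyc f (fun x : kbasis t => v (val x)).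
    by apply/ZcycE; rewrite -[RHS]hv0; congr (kbd f _); rewrite -[RHS]kemb_kres.
  exists (single w); first by apply/supp_comp => i p hi; apply: comp_single_ne.
  rewrite -[RHS]kemb_kres //; congr kemb; apply/ffunP => J; rewrite !ffunE hw.
  by apply: eq_lin_app => q; rewrite comp_single.
- move=> e u; apply: comp_ext => i p; rewrite comp_trunc !comp_fd -(lin_app_graded _ _ _ (@hd i)).
  by apply: eq_lin_app => q; rewrite comp_trunc.
- move=> e u; rewrite -kemb_graded; congr kemb; apply/ffunP => J; rewrite !ffunE.
  rewrite -(lin_app_graded _ _ _ hd0).
  by apply: eq_lin_app => q; rewrite comp_trunc.
Qed.

End Flatten.

Theorem flat_of_reg_le a : reg_le (kdeg df (t := t)) (Zcyc f (t := t)) a ->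
  exists F : flat_resolution f df t a, True.
Proof.
move=> [r [dg [d0 [d [[N hN] [h1 [h2 [h3 [h4 [h5 h6]]]]]]]]]].
exact: (flatten_resolution hN h1 h2 h3 h4 h5 h6).
Qed.

End KoszulCycles.

(** * Ideals of dimension zero contain powers of the variables *)

Section Primary.
Variables (K : fieldType) (n m : nat).
Local Notation P := {mpoly K[n]}.
Variables (f : 'I_m -> P) (df : 'I_m -> nat).
Hypothesis hf : forall i, f i \is (df i).-homog.
Local Notation I := (in_gen_ideal f predT).

Lemma in_gen_ideal0 : I 0.
Proof. by exists (fun _ => 0); rewrite big1 // => i _; rewrite mul0r. Qed.

Lemma in_gen_idealD g h : I g -> I h -> I (g + h).
Proof.
move=> [c ->] [d ->]; exists (fun i => c i + d i); rewrite -big_split.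
by apply: eq_bigr => i _; rewrite /= mulrDl.
Qed.

Lemma in_gen_idealM a g : I g -> I (a * g).
Proof.
move=> [c ->]; exists (fun i => a * c i); rewrite mulr_sumr.
by apply: eq_bigr => i _; rewrite mulrA.
Qed.

Lemma in_gen_ideal_tr e g : I g -> I (tr e g).
Proof.
move=> [c ->]; exists (fun i => tr (e - (df i)%:Z) (c i)); rewrite raddf_sum.
by apply: eq_bigr => i _; rewrite -(tr_mul_homog _ _ (hf i)) subrK.
Qed.

(** The ideal is homogeneous, so it contains the component of degree [q], which is [x_j^q] times the
    nonzero constant term of [g]; a difference of two truncations isolates it. *)
Lemma in_gen_ideal_lowest (j : 'I_n) q g : g@_0%MM != 0 -> I ('X_j ^+ q * g) -> I ('X_j ^+ q).
Proof.
move=> hg hI; set x := 'X_j ^+ q in hI *; set c := g@_0%MM in hg *.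
have hx : x \is q.-homog.
  by rewrite /x; have := @dhomogMn n K mdeg 1 'X_j q; rewrite mul1n; apply; rewrite dhomogX /= mdeg1.
have e1 : tr (-1) g = g by apply: tr_id.
have e2 : tr 0 g = g - c%:MP.
  apply/mpolyP => k; rewrite mcoeff_tr mcoeffB mcoeffC.
  have [->|h] := eqVneq k 0%MM; first by rewrite mdeg0 mulr1 subrr.
  by rewrite mulr0 subr0 ltz_nat lt0n mdeg_eq0 h.
have h3 : I (tr (-1 + q%:Z) (g * x) - tr (0 + q%:Z) (g * x)).
  have hI' : I (g * x) by rewrite mulrC.
  apply: in_gen_idealD; first exact: in_gen_ideal_tr.
  by rewrite -mulN1r; apply: in_gen_idealM; apply: in_gen_ideal_tr.
move: h3; rewrite !(tr_mul_homog _ _ hx) e1 e2 -mulrBl opprB addrC subrK => h3.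
by have := in_gen_idealM (c^-1)%:MP h3; rewrite mulrA -mpolyCM mulVf // mpolyC1 mul1r.
Qed.

(* A prime containing the ideal but avoiding all [x_j^q g] with [g(0) <> 0] lies
   strictly below the prime [(x_1, ..., x_n)]. *)
Theorem dim_zero_power (j : 'I_n) : krull_dim_quot_zero I -> exists q, I ('X_j ^+ q).
Proof.
move=> [_ hmin]; apply: NNPP => /not_ex_all_not hno.
(* The elements [x_j^q g] with [g(0) <> 0] form a multiplicative set, so an ideal maximal among
   those avoiding it is prime. *)
pose good (Q : P -> Prop) := [/\ Q 0, (forall g h, Q g -> Q h -> Q (g + h)),
  (forall g h, Q h -> Q (g * h)), (forall g, I g -> Q g) &
  (forall q g, g@_0%MM != 0 -> ~ Q ('X_j ^+ q * g))].
have goodI : good I.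
  split=> //; [exact: in_gen_ideal0 | exact: in_gen_idealD | exact: in_gen_idealM|].
  by move=> q g hg /(in_gen_ideal_lowest hg); apply: hno.
pose T := {Q : P -> Prop | good Q}.
pose R (Q1 Q2 : T) := boolp.asbool (forall g, sval Q1 g -> sval Q2 g).
have [|||[Q hQ] hmax] := @classical_sets.ZL_preorder T (exist _ I goodI) R.
- by move=> Q; apply/boolp.asboolP.
- by move=> Q1 Q2 Q3 /boolp.asboolP h1 /boolp.asboolP h2; apply/boolp.asboolP => g /h1 /h2.
(* Adjoining the ideal itself to the union provides an upper bound for the empty chain too. *)
- move=> A hA; pose U g := I g \/ exists2 Q : T, A Q & sval Q g.
  have goodU : good U.
    split.
    - by left; exact: in_gen_ideal0.
    - move=> g h [hg|[Q1 a1 h1]] [hh|[Q2 a2 h2]].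
      + by left; exact: in_gen_idealD.
      + right; exists Q2 => //; case: (Q2) h2 => Q [_ QD _ QI _] /= h2.
        by apply: QD => //; apply: QI.
      + right; exists Q1 => //; case: (Q1) h1 => Q [_ QD _ QI _] /= h1.
        by apply: QD => //; apply: QI.
      + right; have [/boolp.asboolP le|/boolp.asboolP le] := hA _ _ a1 a2.
          by exists Q2 => //; case: (Q2) le h2 => Q [_ QD _ _ _] /= le h2; apply: QD => //; apply: le.
        by exists Q1 => //; case: (Q1) le h1 => Q [_ QD _ _ _] /= le h1; apply: QD => //; apply: le.
    - move=> g h [hh|[Q1 a1 h1]]; first by left; exact: in_gen_idealM.
      by right; exists Q1 => //; case: (Q1) h1 => Q [_ _ QM _ _] /= h1; apply: QM.
    - by left.
    - move=> q g hg [hI|[[Q hQ] a1 /= h1]]; first by case: goodI => _ _ _ _ /(_ q g hg).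
      by have [_ _ _ _ /(_ q g hg)] := hQ.
  exists (exist _ U goodU) => Q aQ; apply/boolp.asboolP => g hg.
  by right; exists Q.
have [Q0 QD QM QI Qavoid] := hQ.
have Q_avoid1 g : g@_0%MM != 0 -> ~ Q g by move=> hg; have := Qavoid 0%N g hg; rewrite expr0 mul1r.
have one0 : (1 : P)@_0%MM != 0 by rewrite mcoeff1 eqxx oner_eq0.
(* By maximality, enlarging [Q] by [a] must meet the multiplicative set. *)
have hit a : ~ Q a -> exists q g c p, [/\ g@_0%MM != 0, Q p & 'X_j ^+ q * g = p + c * a].
  move=> ha; apply: NNPP => hn; apply: ha.
  pose Qa g := exists p c, Q p /\ g = p + c * a.
  have goodQa : good Qa.
    split.
    - by exists 0, 0; rewrite mul0r addr0.
    - move=> _ _ [p1 [c1 [h1 ->]]] [p2 [c2 [h2 ->]]]; exists (p1 + p2), (c1 + c2).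
      by split; [exact: QD | rewrite mulrDl addrACA].
    - move=> g _ [p [c [h ->]]]; exists (g * p), (g * c).
      by split; [exact: QM | rewrite mulrDr mulrA].
    - by move=> g /QI hg; exists g, 0; rewrite mul0r addr0.
    - by move=> q g hg [p [c [h e]]]; apply: hn; exists q, g, c, p.
  have /boolp.asboolP h : R (exist _ Qa goodQa) (exist _ Q hQ).
    by apply: hmax; apply/boolp.asboolP => g /= hg; exists g, 0; rewrite mul0r addr0.
  by apply: (h a); exists 0, 1; rewrite mul1r add0r.
have Qprime : is_prime_ideal Q.
  split=> //; first exact: Q_avoid1.
  move=> a b hab; apply: NNPP => /not_or_and [/hit ha /hit hb].
  have [q1 [g1 [c1 [p1 [z1 h1 e1]]]]] := ha; have [q2 [g2 [c2 [p2 [z2 h2 e2]]]]] := hb.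
  apply: (Qavoid (q1 + q2)%N (g1 * g2)); first by rewrite rmorphM mulf_neq0.
  rewrite exprD mulrACA e1 e2.
  have -> : (p1 + c1 * a) * (p2 + c2 * b) = (p2 + c2 * b) * p1 + (c1 * a) * p2 + (c1 * c2) * (a * b).
    by ring.
  by apply: (QD); [apply: (QD); apply: (QM) | apply: (QM)].
pose Mx (g : P) := g@_0%MM = 0.
have Mprime : is_prime_ideal Mx.
  split; rewrite /Mx.
  - by rewrite mcoeff0.
  - by move=> a b; rewrite mcoeffD => -> ->; rewrite addr0.
  - by move=> a b hb; rewrite rmorphM /= hb mulr0.
  - exact/eqP.
  - by move=> a b /eqP; rewrite rmorphM /= mulf_eq0 => /orP[/eqP|/eqP]; [left|right].
(* Avoidance with exponent 0 excludes nonzero constant terms, so [Q] lies below [Mx]. Dimension zero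
   forces equality, yet [x_j] itself belongs to the avoided set. *)
have QM' g : Q g -> Mx g by move=> hg; apply/eqP/negPn/negP => /Q_avoid1; apply.
have MX : Mx 'X_j by rewrite /Mx mcoeffX mnm1_eq0.
have QX := hmin Q Mx Qprime Mprime QI QM' 'X_j MX.
by apply: (Qavoid 1%N 1 one0); rewrite expr1 mulr1.
Qed.

End Primary.

(** * Koszul cycles as a summand of the bicycles, and the conclusion *)

Section Main.
Variables (K : fieldType) (n m : nat).
Local Notation P := {mpoly K[n]}.
Local Notation fvec := (@fvec K n).
Variables (f : 'I_m -> P) (df : 'I_m -> nat).
Hypothesis hf : forall i, f i \is (df i).-homog.

Definition kcycles t (v : fvec (kbasis m t)) : Prop := kbd f (kemb v) = 0.

Lemma kcycles_graded t : graded_submodule (kdeg df (t := t)) (@kcycles t).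
Proof.
rewrite /kcycles; split.
- by rewrite !raddf0.
- by move=> u v hu hv; rewrite !raddfB /= hu hv subrr.
- by move=> a u hu; rewrite !linearZ /= hu scaler0.
- by move=> e u hu; rewrite kemb_graded (kbd_graded hf) hu raddf0.
Qed.

Lemma reg_le_kcycles t a :
  reg_le (kdeg df (t := t)) (fun v => kcycles (finfun v)) a ->
  reg_le (kdeg df (t := t)) (Zcyc f (t := t)) a.
Proof.
move=> [r [dg [d0 [d [h0 [h1 [h2 [h3 h4]]]]]]]]; exists r, dg, d0, d.
by do 4!split => //; move=> v; rewrite ZcycE; exact: h3.
Qed.

(** A characteristic dividing the binomial coefficient divides [(s + t)!], hence one of the factors,
    and is at most [s + t]. *)
Lemma bin_unit s t : (forall p : nat, p \in [pchar K] -> (s + t < p)%N) ->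
  'C(s + t, s)%:R != 0 :> K.
Proof.
move=> hp; apply/negP => h.
have hb : (0 < 'C(s + t, s))%N by rewrite bin_gt0 leq_addr.
have [p hpc] := natf0_pchar hb h.
have p_pr : prime p by case/andP: hpc.
have : (p %| (s + t)`!)%N.
  by rewrite -(bin_fact (leq_addr t s)) dvdn_mulr // (dvdn_pcharf hpc).
elim: (s + t)%N (hp p hpc) => [_|N IH hN]; first by rewrite fact0 dvdn1 => /eqP e; rewrite e in p_pr.
rewrite factS Euclid_dvdM // => /orP[hd|]; last by apply: IH; apply: ltnW.
by have := dvdn_leq (ltn0Sn N) hd; rewrite leqNgt hN.
Qed.

(* Comultiplication and multiplication exhibit the [s+t]-cycles as a direct
   summand of the module of bicycles, as their composite is a binomial coefficient. *)
Lemma kvan_kcycles s t c i : 'C(s + t, s)%:R != 0 :> K ->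
  kvan (tdeg (sdeg df) (sdeg df))
    (fun u => supp [pred p : {set 'I_m} * {set 'I_m} | (#|p.1| == s) && (#|p.2| == t)] u /\
       biboundary f u = 0) i c ->
  kvan (kdeg df (t := s + t)) (@kcycles (s + t)) i c.
Proof.
move=> hC hK z hz hd.
pose iota : {linear fvec (kbasis m (s + t)) -> _} := @ecomul K n m s t \o @kemb K n m (s + t).
pose pi : {linear _ -> fvec (kbasis m (s + t))} := @kres K n m (s + t) \o @emul K n m.
pose x : P := ('C(s + t, s)%:R^-1)%:MP.
have [||w hw ew] := hK (kmap iota z).
- apply: kin_kmap hz; first exact: raddf0.
  move=> u [hu hab]; split.
    split; first exact: ecomul_supp.
    by apply/biboundary_eq0; split; [exact: tensl_ecomul | exact: tensr_ecomul].
  apply: (above_map (dg' := tdeg (sdeg df) (sdeg df))) hab => e v.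
  by rewrite /iota /= kemb_graded ecomul_graded.
- by rewrite kd_kmap hd kmap0 // raddf0.
exists (x *: kmap pi w).
  apply: kin_scale (_ : kin (@kcycles (s + t)) _ _).
    by move=> u; case: (kcycles_graded (s + t)) => _ _ ZZ _; exact: ZZ.
  apply: kin_kmap hw; first exact: raddf0.
  move=> u [hs /biboundary_eq0 [hl hr]]; rewrite /kcycles /pi /= kemb_kres; last exact: emul_supp.
  by rewrite kbd_emul hl hr !raddf0 addr0.
have -> : kd (x *: kmap pi w) = x *: kmap (pi \o iota) z.
  by rewrite kdZ kd_kmap ew kmap_comp.
have -> : kmap (pi \o iota) z = 'C(s + t, s)%:R *: z.
  rewrite -kmap_scale; apply: kmap_eq hz; rewrite ?raddf0 ?scaler0 // => u _.
  by rewrite /pi /iota /= emul_ecomul ?linearZ /= ?kres_kemb //; exact: kemb_supp.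
by rewrite scalerA /x -mpolyC_nat -mpolyCM mulVf // mpolyC1 scale1r.
Qed.

End Main.

(* In zero variables the only proper ideal is [0], with no minimal generators. *)
Lemma no_generators_over_field (K : fieldType) (m : nat) (f : 'I_m -> {mpoly K[0]}) :
  minimal_generators f -> krull_dim_quot_zero (in_gen_ideal f predT) -> m = 0%N.
Proof.
case: m f => // m f hmin [[Q [[_ _ QM Q1 _] hQ]] _]; case: Q1.
have h0 : (f ord0)@_0%MM != 0.
  apply/eqP => e; apply: (hmin ord0); exists (fun _ => 0).
  by rewrite [LHS]nvar0_mpolyC e mpolyC0 big1 // => i _; rewrite mul0r.
have <- : ((f ord0)@_0%MM)^-1%:MP * f ord0 = 1.
  by rewrite [f ord0 in X in _ * X]nvar0_mpolyC -mpolyCM mulVf // mpolyC1.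
apply: QM; apply: hQ; exists (fun i => (i == ord0)%:R).
rewrite (bigD1 ord0) //= ?eqxx mul1r big1 ?addr0 // => i /negbTE ->; exact: mul0r.
Qed.

(** Without generators the cycles vanish in positive positions, where every bound holds. A negative
    bound could do harm only for [s = t = 0], and there the cycles are the field in degree 0, which
    forces [a] and [b] to be nonnegative. *)
Lemma reg_le_zero_variables (K : fieldType) (f : 'I_0 -> {mpoly K[0]}) (df : 'I_0 -> nat)
    (s t : nat) (a b : int) :
  reg_le (kdeg df (t:=s)) (Zcyc f (t:=s)) a ->
  reg_le (kdeg df (t:=t)) (Zcyc f (t:=t)) b ->
  reg_le (kdeg df (t:=s + t)) (Zcyc f (t:=s + t)) (a + b).
Proof.
have hf i : f i \is (df i).-homog by case: i.
have pos (c : int) : reg_le (kdeg df (t:=0)) (Zcyc f (t:=0)) c -> 0 <= c.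
  move=> [r [dg [d0 [d [_ [_ [_ [hM [_ [_ hdeg]]]]]]]]]].
  have h0 : #|(set0 : {set 'I_0})| == 0%N by rewrite cards0.
  have [u hu] : in_im d0 (fun _ => 1).
    by apply/hM => J; apply: big1 => J0 _; rewrite /kdiff big1 ?mulr0 // => -[].
  case E : (r 0%N) => [|r0]; last by have := hdeg 0%N (cast_ord (esym E) ord0); lia.
  have no_gen (p : 'I_(r 0%N)) : False by move: p; rewrite E; case.
  have := hu (exist _ set0 h0); rewrite /lin_app big1 => [/eqP|p]; last by case: (no_gen p).
  by rewrite oner_eq0.
move=> hs ht; apply: reg_le_kcycles; apply: reg_le_of_kvan; first exact: kcycles_graded.
move=> [|i] z /= hz _; last by exists 0; rewrite ?hz.
exists 0 => //; case: hz => _ /aboveP hab; apply/esym/ffunP => J; apply/mpolyP => k.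
rewrite fvE mcoeff0; apply/eqP/negPn/negP => /hab.
have hJ : val J = set0 by apply/setP => -[].
have := valP J; rewrite hJ cards0 eq_sym addn_eq0 => /andP[/eqP es /eqP et].
rewrite es in hs; rewrite et in ht; have := pos _ hs; have := pos _ ht.
rewrite /kdeg hJ big_set0 mdegE big_ord0; lia.
Qed.

Theorem theorem3p1 (K : fieldType) (n m : nat) (f : 'I_m -> {mpoly K[n]})
    (df : 'I_m -> nat) (s t : nat) :
  (forall i, f i \is (df i).-homog) ->
  minimal_generators f ->
  krull_dim_quot_zero (in_gen_ideal f predT) ->
  (forall p : nat, p \in [pchar K] -> (s + t < p)%N) ->
  forall a b : int,
    reg_le (kdeg df (t:=s)) (Zcyc f (t:=s)) a ->
    reg_le (kdeg df (t:=t)) (Zcyc f (t:=t)) b ->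
    reg_le (kdeg df (t:=s + t)) (Zcyc f (t:=s + t)) (a + b).
Proof.
move=> hf hmin hdim hchar a b hs ht.
(* The descent over the variables needs at least one of them: it then starts in a position of
   [F (x) G], where generator degrees are bounded. *)
case: n f hf hmin hdim hs ht => [|n] f hf hmin hdim hs ht.
  have em := no_generators_over_field hmin hdim; subst m.
  exact: reg_le_zero_variables.
have [F _] := flat_of_reg_le hs; have [G _] := flat_of_reg_le ht.
apply: reg_le_kcycles; apply: reg_le_of_kvan; first exact: kcycles_graded.
move=> i; apply: (kvan_kcycles hf (bin_unit hchar)).
by apply: (kvan_bicycles hf F G) => // j; apply: dim_zero_power hf _ hdim.
Qed.
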